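(* Let $\psi(s)=c_0s+\varphi(s)\in\mathfrak{G}_{\geq 1}$. Then $\psi$ induces a bounded composition operator $C_\psi$ on $\mathcal{H}^2_\Lambda$, and its operator norm is $\|C_\psi\|=1$.
   Context: For $\theta\in\mathbb{R}$, $\mathbb{C}_\theta=\{z\in\mathbb{C}:\operatorname{Re}z>\theta\}$. Generalized integers: let $\{p_n\}_{n\ge1}$ be the increasing sequence of (ordinary) primes and let $\{q_n\}_{n\ge1}$ be an increasing, unbounded sequence of real numbers, each greater than $1$, such that the set $\{\log p_n\}_{n\ge1}\cup\{\log q_n\}_{n\ge1}$ is $\mathbb{Q}$-linearly independent. Let $\{\lambda_n\}_{n\ge1}$ be the increasing enumeration of all finite products (with repetition allowed, including the empty product $1$) of elements of $\{p_n\}\cup\{q_n\}$. $\mathcal{H}^2_\Lambda$ is the Hilbert space of (formal) generalized Dirichlet series $f(s)=\sum_{n\ge1}a_n\lambda_n^{-s}$ with norm $\|f\|^2=\sum_{n\ge1}|a_n|^2<\infty$. $\mathcal{H}^2$ is the subspace of ordinary Dirichlet series $\sum_{n\ge1}a_nn^{-s}$ with $\sum|a_n|^2<\infty$. The class $\mathfrak{G}_{\ge1}$ consists of all functions $\psi(s)=c_0s+\varphi(s)$ where $c_0\ge1$ is an integer and $\varphi(s)=\sum_{n\ge1}c_nn^{-s}$ is an ordinary Dirichlet series, converging uniformly in $\mathbb{C}_\varepsilon$ for every $\varepsilon>0$, such that either $\varphi(\mathbb{C}_0)\subset\mathbb{C}_0$ or $\varphi\equiv i\tau$ for some $\tau\in\mathbb{R}$.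 The composition operator is $C_\psi f=f\circ\psi$. On finite sums $f$ of terms $a_n\lambda_n^{-s}$ it is given by $\lambda_n^{-s}\mapsto\lambda_n^{-\psi(s)}=(\lambda_n^{c_0})^{-s}\lambda_n^{-\varphi(s)}$, where $\lambda_n^{-\varphi(s)}$ is a bounded ordinary Dirichlet series on $\mathbb{C}_0$, so that the image belongs to $\mathcal{H}^2_\Lambda$. That $\psi$ induces a bounded operator on $\mathcal{H}^2_\Lambda$ means that this densely defined linear map extends to a bounded operator on $\mathcal{H}^2_\Lambda$, again denoted $C_\psi$. *)

(* Defs.v *)
From HB Require Import structures.
From mathcomp Require Import all_boot all_order all_algebra.
From mathcomp Require Import complex.
From mathcomp Require Import all_classical all_reals all_analysis.
From mathcomp Require Import ring.
Set Implicit Arguments.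
Unset Strict Implicit.
Unset Printing Implicit Defensive.
Import Order.TTheory GRing.Theory Num.Theory.
Import numFieldNormedType.Exports.
Import ComplexField.Normc.
Local Open Scope classical_set_scope.
Local Open Scope ring_scope.
Local Open Scope complex_scope.

(* The library puts the topology of a numFieldType K on the alias K^o; here it
   is transferred to R[i] itself. *)
HB.instance Definition _ (R : realType) := GRing.ComAlgebra.copy R[i] R[i]^o.
HB.instance Definition _ (R : realType) := Vector.copy R[i] R[i]^o.
HB.instance Definition _ (R : realType) := NormedModule.copy R[i] R[i]^o.

Section Exponentials.
Variable R : realType.
Implicit Types (z s : R[i]) (x theta : R).

Definition cexp z : R[i] :=
  (expR (complex.Re z))%:C * (cos (complex.Im z) +i* sin (complex.Im z)).

(* x ^ (- s), for x > 0 *)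
Definition powN x s : R[i] := cexp (- ((ln x)%:C * s)).

Definition halfplane theta : set R[i] := [set s | theta < complex.Re s].

End Exponentials.

Section GeneralizedIntegers.
Variable R : realType.
Implicit Types (q lam : nat -> R) (S : set R).

Definition Q_linearly_independent S :=
  forall (n : nat) (x : 'I_n -> R) (c : 'I_n -> rat),
    injective x -> (forall i, S (x i)) ->
    \sum_(i < n) ratr (c i) * x i = 0 -> forall i, c i = 0.

Definition generators q : set R :=
  [set p%:R | p in [set p : nat | prime p]] `|` range q.

Definition finite_products S : set R :=
  [set x | exists2 s : seq R, (forall y, y \in s -> S y) &
                              x = \prod_(y <- s) y].

Definition admissible q :=
  [/\ increasing_seq q, ~ has_ubound (range q), (forall n, 1 < q n) &
      Q_linearly_independent (@ln R @` generators q)].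

(* Sequences are indexed from 0, so lam 0 = 1. *)
Definition generalized_integers q lam :=
  increasing_seq lam /\ range lam = finite_products (generators q).

End GeneralizedIntegers.

Section HardySpace.
Variable R : realType.

Definition square_summable : {pred nat -> R[i]} :=
  fun a => `[< cvgn (series (fun n => normc (a n) ^+ 2)) >].

Lemma square_summableP (a : nat -> R[i]) :
  reflect (cvgn (series (fun n => normc (a n) ^+ 2))) (a \in square_summable).
Proof. exact: asboolP. Qed.

Lemma normcD_sqr_le (x y : R[i]) :
  normc (x + y) ^+ 2 <= 2 * (normc x ^+ 2 + normc y ^+ 2).
Proof.
have h0 (z : R[i]) : 0 <= normc z by case: z => a b; exact: sqrtr_ge0.
apply: (@le_trans _ _ ((normc x + normc y) ^+ 2)).
  by rewrite lerXn2r ?nnegrE ?addr_ge0 ?h0 ?le_normcD.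
rewrite -subr_ge0.
have -> : 2 * (normc x ^+ 2 + normc y ^+ 2) - (normc x + normc y) ^+ 2
    = (normc x - normc y) ^+ 2 by ring.
exact: sqr_ge0.
Qed.

Fact square_summable_submod : GRing.submod_closed square_summable.
Proof.
split=> [|k a b /square_summableP sa /square_summableP sb];
  apply/square_summableP.
  rewrite (_ : series _ = cst 0); first exact: is_cvg_cst.
  apply/funext => n; rewrite /series /= big1 // => i _.
  by rewrite /= expr0n /= addr0 sqrtr0 expr0n.
apply: (@series_le_cvg _ _
  (fun n => 2 * (normc k ^+ 2 * normc (a n) ^+ 2 + normc (b n) ^+ 2))).
- by move=> n; exact: sqr_ge0.
- by move=> n; apply: mulr_ge0 => //; apply: addr_ge0;
    [apply: mulr_ge0|]; exact: sqr_ge0.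
- by move=> n; rewrite -exprMn -normcM; exact: normcD_sqr_le.
have sa' := @is_cvg_seriesZ _ _ (normc k ^+ 2) sa.
exact: (@is_cvg_seriesZ _ _ 2 (is_cvg_seriesD sa' sb)).
Qed.

HB.instance Definition _ :=
  GRing.isSubmodClosed.Build R[i] (nat -> R[i]) square_summable
    square_summable_submod.

(* The formal series sum_n (f n) lam_n^(-s), identified with its coefficient
   sequence; it need not converge anywhere. As a Hilbert space it does not
   depend on lam, which only enters through [gds_term]. *)
Record H2 := MkH2 { coef :> nat -> R[i]; _ : coef \in square_summable }.

HB.instance Definition _ := [isSub of H2 for coef].
HB.instance Definition _ := [Choice of H2 by <:].
HB.instance Definition _ := [SubChoice_isSubLmodule of H2 by <:].

Definition H2norm (f : H2) : R :=
  Num.sqrt (limn (series (fun n => normc (f n) ^+ 2))).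

Definition bounded_operator (T : H2 -> H2) :=
  exists M : R, forall f, H2norm (T f) <= M * H2norm f.

Definition operator_norm (T : H2 -> H2) : R :=
  sup [set H2norm (T f) | f in [set f | H2norm f <= 1]].

Definition gds_term (lam : nat -> R) (f : H2) (s : R[i]) : nat -> R[i] :=
  fun n => f n * powN (lam n) s.

(* A Dirichlet series with only finitely many nonzero coefficients composed
   with psi has frequencies lam_n^c0 * k with k an integer, so by
   Cauchy-Schwarz its series converges absolutely on Re s > 1/2, and there
   determines the coefficients. *)
Definition represents (lam : nat -> R) (g : H2) (F : R[i] -> R[i]) :=
  forall s, halfplane 2^-1 s ->
    cvgn (series (fun n => normc (gds_term lam g s n))) /\
    series (gds_term lam g s) @ \oo --> F s.

Definition composition_operator (lam : nat -> R) (psi : R[i] -> R[i])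
    (T : {linear H2 -> H2}) :=
  bounded_operator T /\
  forall (f : H2) (N : nat), (forall n, (N <= n)%N -> f n = 0) ->
    represents lam (T f) (fun s => \sum_(n < N) gds_term lam f (psi s) n).

End HardySpace.

Section GordonHedenmalmClass.
Variable R : realType.

(* The coefficient c n is that of (n + 1)^(-s). *)
Definition dirichlet_series (c : nat -> R[i]) : nat -> R[i] -> R[i] :=
  fun N s => series (fun n => c n * powN n.+1%:R s) N.

(* Functions on the half-plane Re s > 0 are total functions on R[i] whose
   values elsewhere are irrelevant. *)
Definition G_ge1 (psi : R[i] -> R[i]) :=
  exists (c0 : nat) (c : nat -> R[i]) (phi : R[i] -> R[i]),
    [/\ (1 <= c0)%N,
        forall s, halfplane 0 s -> psi s = c0%:R * s + phi s,
        forall eps : R, 0 < eps ->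
          {uniform halfplane eps, dirichlet_series c @ \oo --> phi} &
        phi @` halfplane 0 `<=` halfplane 0 \/
        exists tau : R, forall s, halfplane 0 s -> phi s = 0 +i* tau].

End GordonHedenmalmClass.

(* Main.v *)
(* Write l_n = ln lam_n and let f = sum_(n < N) a_n lam_n^(-s) be a finite sum.
   Horner's scheme gives f o psi = g_0, where g_N = 0 and
     g_k = a_k + e^(-(l_(k+1) - l_k) psi) g_(k+1).
   For x > 0 the function e^(-x psi) = e^(-x c0 s) e^(-x phi) is at most 1 in
   modulus and is a uniform limit of sums of exponentials with positive
   frequencies. Its mean along vertical lines is therefore 0, the two summands
   of g_k are orthogonal in mean, and the mean square of f o psi is at most
   sum |a_n|^2. Bessel's inequality for these means bounds the coefficients of
   f o psi on Re s = sigma, and sigma -> 0 shows that C_psi is a contraction; it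
   fixes the constant function 1. *)
Require Import Defs.
From HB Require Import structures.
From mathcomp Require Import all_boot all_order all_algebra.
From mathcomp Require Import complex.
From mathcomp Require Import all_classical all_reals all_analysis.
From mathcomp Require Import ring lra.
Set Implicit Arguments.
Unset Strict Implicit.
Unset Printing Implicit Defensive.
Import Order.TTheory GRing.Theory Num.Theory.
Import numFieldNormedType.Exports.
Import ComplexField.Normc.
Local Open Scope classical_set_scope.
Local Open Scope ring_scope.
Local Open Scope complex_scope.

(** No integral is taken: means are limits of finite averages, so orthogonality of exponentials
    comes down to a geometric sum. That e^(-x phi) is a uniform limit of exponential sums on Re s >
    eps rests on phi being bounded there, itself a uniform limit of bounded sums; e^z can then be
    replaced by the polynomial (1 + z/m)^m. The factor e^(-x c0 s) shifts the resulting frequencies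
    ln k by x c0 > 0.

    The obstacle is that the sum of lam_j^(-x) may diverge for every x, so f need not converge and f
    o psi has no direct meaning. The operator is therefore built from the matrix whose row n holds
    the mean coefficients of lam_n^(-psi). A row lives on the frequencies lam_n^c0 k, as sparse as
    the integers, so it does sum to lam_n^(-psi) on Re s > 1/2. The bound for finite sums extends
    the matrix to the whole space, and uniqueness of coefficients identifies it with any operator
    that the definition admits. *)

Section ComplexPrelim.
Variable R : realType.
Implicit Types (z w : R[i]) (u : nat -> R[i]).

Lemma norm_normc z : `|z| = (normc z)%:C.
Proof. by rewrite normc_def; case: z. Qed.

Lemma normc_ge0 z : 0 <= normc z.
Proof. by case: z => a b; exact: sqrtr_ge0. Qed.

Lemma sqr_normc z : normc z ^+ 2 = complex.Re z ^+ 2 + complex.Im z ^+ 2.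
Proof. by case: z => a b /=; rewrite sqr_sqrtr// addr_ge0// sqr_ge0. Qed.

Lemma normc_real (x : R) : normc x%:C = `|x|.
Proof. by rewrite /= expr0n /= addr0 sqrtr_sqr. Qed.

Lemma norm_Re_le z : `|complex.Re z| <= normc z.
Proof.
rewrite -ler_sqr ?nnegrE ?normc_ge0// sqr_normc -normrX ger0_norm ?sqr_ge0//.
by rewrite lerDl sqr_ge0.
Qed.

Lemma norm_Im_le z : `|complex.Im z| <= normc z.
Proof.
rewrite -ler_sqr ?nnegrE ?normc_ge0// sqr_normc -normrX ger0_norm ?sqr_ge0//.
by rewrite lerDr sqr_ge0.
Qed.

Lemma normc_le_ReIm z : normc z <= `|complex.Re z| + `|complex.Im z|.
Proof.
rewrite -ler_sqr ?nnegrE ?normc_ge0 ?addr_ge0// sqr_normc sqrrD !real_normK ?num_real//.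
by have := mulr_ge0 (normr_ge0 (complex.Re z)) (normr_ge0 (complex.Im z)); lra.
Qed.

Lemma normcX z n : normc (z ^+ n) = normc z ^+ n.
Proof. by elim: n => [|n IH]; rewrite ?normc1// !exprS normcM IH. Qed.

Lemma normc_sum (I : Type) (r : seq I) (P : pred I) (F : I -> R[i]) :
  normc (\sum_(i <- r | P i) F i) <= \sum_(i <- r | P i) normc (F i).
Proof.
apply: (big_ind2 (fun z (x : R) => normc z <= x)) => //; first by rewrite normc0.
by move=> z1 x1 z2 x2 h1 h2; rewrite (le_trans (le_normcD _ _))// lerD.
Qed.

Lemma normcBC z w : normc (z - w) = normc (w - z).
Proof. by rewrite -normcN opprB. Qed.

Lemma normc_tri t z w : normc (z - w) <= normc (z - t) + normc (t - w).
Proof. by rewrite (le_trans _ (le_normcD _ _))// subrKA. Qed.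

Lemma cvgcP u z : u @ \oo --> z <->
  forall e : R, 0 < e -> \forall n \near \oo, normc (z - u n) <= e.
Proof.
split=> [/cvgrPdist_le h e e0|h].
  have e0' : (0 : R[i]) < e%:C by rewrite ltcR.
  by apply: filterS (h _ e0') => n; rewrite norm_normc lecR.
apply/cvgrPdist_le => -[e e'] /=; rewrite ltcE /= => /andP[/eqP -> e0].
by apply: filterS (h _ e0) => n; rewrite norm_normc lecR.
Qed.

Lemma cvgc_normc u z : u @ \oo --> z -> normc (u n) @[n --> \oo] --> normc z.
Proof.
move=> /cvgcP h; apply/cvgrPdist_le => e /h; apply: filterS => n.
apply: le_trans; rewrite ler_norml; apply/andP; split.
  have := le_normcD (u n - z) z; rewrite subrK normcBC; lra.
have := le_normcD (z - u n) (u n); rewrite subrK; lra.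
Qed.

Lemma cvgc_unique u z w : u @ \oo --> z -> u @ \oo --> w -> z = w.
Proof. exact: (@cvg_unique _ (@norm_hausdorff _ _)). Qed.

(* R[i] is not registered as a complete space. *)
Lemma cvgc_cauchy u :
  (forall e : R, 0 < e -> exists N, forall m n, (N <= m)%N -> (N <= n)%N ->
     normc (u m - u n) <= e) -> exists z, u @ \oo --> z.
Proof.
move=> h.
have key (v : nat -> R) : (forall m n, `|v m - v n| <= normc (u m - u n)) ->
    cvgn v.
  move=> hv; apply/cauchy_cvgP/cauchy_exP => e e0.
  have e2 : 0 < e / 2 by lra.
  have [N hN] := h _ e2.
  exists (v N); exists N => // n /= Nn.
  rewrite /ball /=; apply: le_lt_trans (hv _ _) _.
  by apply: le_lt_trans (hN _ _ (leqnn N) Nn) _; lra.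
have hr : cvgn (fun n => complex.Re (u n)).
  by apply: key => m n; rewrite -raddfB; exact: norm_Re_le.
have hi : cvgn (fun n => complex.Im (u n)).
  by apply: key => m n; rewrite -raddfB; exact: norm_Im_le.
exists (limn (fun n => complex.Re (u n)) +i* limn (fun n => complex.Im (u n))).
apply/cvgcP => e e0; have e2 : 0 < e / 2 by lra.
move/cvgrPdist_le : hr => /(_ _ e2) hr; move/cvgrPdist_le : hi => /(_ _ e2) hi.
apply: filterS2 hr hi => n h1 h2; rewrite (le_trans (normc_le_ReIm _))//.
by case: (u n) h1 h2 => a b /=; lra.
Qed.

End ComplexPrelim.

(** * Functional equation and modulus of the complex exponential *)

Section ComplexExponential.
Variable R : realType.
Implicit Types (z w s : R[i]) (x y : R).

Lemma cexpD z w : cexp (z + w) = cexp z * cexp w.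
Proof.
rewrite /cexp; case: z => a b; case: w => c d /=.
rewrite expRD cosD sinD; apply/eqP; rewrite eq_complex /=.
by apply/andP; split; apply/eqP; ring.
Qed.

Lemma cexp0 : cexp 0 = 1 :> R[i].
Proof.
by rewrite /cexp /= expR0 cos0 sin0; apply/eqP; rewrite eq_complex /=; apply/andP; split; apply/eqP; ring.
Qed.

Lemma normc_cexp z : normc (cexp z) = expR (complex.Re z).
Proof.
rewrite /cexp normcM normc_real ger0_norm ?expR_ge0//=.
by rewrite cos2Dsin2 sqrtr1 mulr1.
Qed.

Lemma cexpMn z n : cexp (z *+ n) = cexp z ^+ n.
Proof. by elim: n => [|n IH]; rewrite ?cexp0// mulrS cexpD IH exprS. Qed.

End ComplexExponential.

(** * Approximation of the exponential by (1 + z/m)^m, uniformly on bounded sets *)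

Section ExponentialApproximation.
Variable R : realType.
Implicit Types (z w s : R[i]) (x y u v : R).

Lemma norm_sin_le v : `|sin v| <= `|v|.
Proof.
wlog v0 : v / 0 <= v => [h|].
  have [/h//|/ltW v0] := leP 0 v.
  by rewrite -normrN -sinN -(normrN v) h// oppr_ge0.
have [c _] := @MVT_segment R (@sin R) (@cos R) 0 v v0
  (fun x _ => is_derive_sin x) (continuous_subspaceT (@continuous_sin R)).
rewrite sin0 !subr0 => ->; rewrite normrM ler_piMl// ler_norml cos_geN1 cos_le1//.
Qed.

Lemma cos_ge_quadratic v : 1 - v ^+ 2 / 2 <= cos v.
Proof.
have -> : cos v = 1 - sin (v / 2) ^+ 2 *+ 2.
  rewrite [in LHS](_ : v = v / 2 *+ 2); last by rewrite -mulr_natr divfK.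
  by rewrite cos_mulr2n cos2sin2; ring.
rewrite lerD2l lerN2.
have : sin (v / 2) ^+ 2 <= (v / 2) ^+ 2.
  by rewrite -ler_sqrt ?sqr_ge0// !sqrtr_sqr norm_sin_le.
lra.
Qed.

(** For v >= 0 the mean value theorem gives (cos c - 1) v with c in [0, v], and c^2 <= v because v
    <= 1. The true cubic order is given up, as only quadratic errors matter below. *)
Lemma norm_sinB_le v : `|v| <= 1 -> `|sin v - v| <= v ^+ 2 / 2.
Proof.
wlog v0 : v / 0 <= v => [h|].
  have [/h//|/ltW v0] := leP 0 v.
  have -> : sin v - v = - (sin (- v) - (- v)) by rewrite sinN; ring.
  by rewrite normrN -(normrN v) -(sqrrN v); apply: h; rewrite oppr_ge0.
have hd x : x \in `]0, v[ -> is_derive x 1 (fun x => sin x - x) (cos x - 1).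
  by move=> _; apply: is_deriveB.
have hc : {within `[0, v], continuous (fun x : R => sin x - x)}.
  apply: continuous_subspaceT => x; apply: cvgB => //; exact: continuous_sin.
have [c] := MVT_segment v0 hd hc.
rewrite in_itv /= => /andP[c0 cv]; rewrite sin0 !subr0 => -> v1.
rewrite normrM (ger0_norm v0); have := cos_ge_quadratic c; have := cos_le1 c.
rewrite ger0_norm// in v1; move=> h1 h2.
rewrite distrC ger0_norm ?subr_ge0//.
have : (1 - cos c) * v <= c ^+ 2 / 2 * v by rewrite ler_wpM2r//; lra.
have : c ^+ 2 <= v * 1 by rewrite expr2 ler_pM//; lra.
nra.
Qed.

(** e^u (1 - u) <= e^u e^(-u) = 1, whereas (1 + u + 2u^2)(1 - u) = 1 + u^2 (1 - 2u) >= 1. *)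
Lemma expR_le_quadratic u : `|u| <= 2^-1 -> expR u <= 1 + u + 2 * u ^+ 2.
Proof.
rewrite ler_norml => /andP[u1 u2].
have h1 := expR_ge1Dx (- u); have := expRxMexpNx_1 u; have := expR_gt0 u.
move: (expR u) (expR (- u)) h1 => a b h1 h2 h3.
have : a * (1 - u) <= 1 by rewrite -[leRHS]h3 ler_wpM2l// ltW.
have : 0 <= u ^+ 2 * (1 - 2 * u) by rewrite mulr_ge0 ?sqr_ge0//; lra.
nra.
Qed.

(** With w = u + iv the remainder splits into four terms, bounded by 2, 1, 1 and 2 times |w|^2;
    hence the constant 6. *)
Lemma normc_cexpB1B w : normc w <= 2^-1 ->
  normc (cexp w - 1 - w) <= 6 * normc w ^+ 2.
Proof.
move=> hw; have := norm_Re_le w; have := norm_Im_le w.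
have -> : cexp w - 1 - w = (expR (complex.Re w) - 1 - complex.Re w)%:C +
   (expR (complex.Re w) * (cos (complex.Im w) - 1))%:C +
   'i * (expR (complex.Re w) * (sin (complex.Im w) - complex.Im w))%:C
   + 'i * ((expR (complex.Re w) - 1) * complex.Im w)%:C.
  rewrite /cexp; case: w hw => u v hw; apply/eqP; rewrite eq_complex /=.
  by apply/andP; split; apply/eqP; ring.
move: hw (normc_ge0 w).
move: (normc w) (complex.Re w) (complex.Im w) => r u v hw r0 hv hu.
have ni : normc ('i : R[i]) = 1 by rewrite /= expr0n /= add0r expr1n sqrtr1.
apply: (le_trans (le_normcD _ _)).
apply: (@le_trans _ _ (2 * r ^+ 2 + r ^+ 2 + r ^+ 2 + 2 * r ^+ 2)); last by lra.
have e1 := expR_ge1Dx u; have e2 : expR u <= 1 + u + 2 * u ^+ 2.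
  by apply: expR_le_quadratic; lra.
have ur : u ^+ 2 <= r ^+ 2 by rewrite -(@real_normK _ u) ?num_real// ler_sqr.
have vr : v ^+ 2 <= r ^+ 2 by rewrite -(@real_normK _ v) ?num_real// ler_sqr.
have r2 : r ^+ 2 <= r / 2 by rewrite expr2 ler_wpM2l//; lra.
have e3 : expR u <= 2 by move: hu; rewrite ler_norml => /andP[]; lra.
have e4 : `|expR u - 1| <= 2 * r.
  by move: hu; rewrite !ler_norml => /andP[? ?]; apply/andP; split; lra.
have e0 := expR_gt0 u.
have e5 : `|cos v - 1| <= r ^+ 2 / 2.
  rewrite distrC ger0_norm ?subr_ge0 ?cos_le1//.
  have := cos_ge_quadratic v; lra.
have e6 : `|sin v - v| <= r ^+ 2 / 2.
  rewrite (le_trans (norm_sinB_le _))//; lra.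
apply: lerD; last first.
  rewrite normcM ni mul1r normc_real normrM.
  apply: (@le_trans _ _ (2 * r * r)); last lra.
  exact: ler_pM.
apply: le_trans (le_normcD _ _) _; apply: lerD; last first.
  rewrite normcM ni mul1r normc_real normrM.
  apply: (@le_trans _ _ (2 * (r ^+ 2 / 2))); last lra.
  by apply: ler_pM => //; rewrite gtr0_norm.
apply: le_trans (le_normcD _ _) _; apply: lerD; last first.
  rewrite normc_real normrM.
  apply: (@le_trans _ _ (2 * (r ^+ 2 / 2))); last lra.
  by apply: ler_pM => //; rewrite gtr0_norm.
rewrite normc_real ger0_norm; lra.
Qed.

Lemma normc_subX_le z w (M : R) n : 1 <= M -> normc z <= M -> normc w <= M ->
  normc (z ^+ n - w ^+ n) <= n%:R * normc (z - w) * M ^+ n.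
Proof.
move=> M1 zM wM; elim: n => [|n IH]; first by rewrite subrr normc0 !mul0r.
have -> : z ^+ n.+1 - w ^+ n.+1 = z * (z ^+ n - w ^+ n) + (z - w) * w ^+ n.
  by rewrite !exprS; ring.
apply: le_trans (le_normcD _ _) _; rewrite !normcM normcX.
have hM : M ^+ n <= M ^+ n.+1 by rewrite exprS ler_peMl// exprn_ge0//; lra.
have wn : normc w ^+ n <= M ^+ n.
  by rewrite lerXn2r ?nnegrE ?normc_ge0//; lra.
have h1 : normc z * normc (z ^+ n - w ^+ n) <=
    M * (n%:R * normc (z - w) * M ^+ n).
  by apply: ler_pM => //; exact: normc_ge0.
have h2 : normc (z - w) * normc w ^+ n <= normc (z - w) * M ^+ n.+1.
  by rewrite ler_wpM2l ?normc_ge0// (le_trans wn).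
by rewrite -natr1 !exprS in h2 *; lra.
Qed.

(** With w = z/m, both e^w and 1 + w have modulus at most e^|w|, so their m-th powers differ by at
    most m |e^w - 1 - w| e^|z| <= 6 B^2 e^B / m. *)
Lemma cexp_uniform_approx (B d : R) : 0 < d -> exists m : nat,
  forall z, normc z <= B -> normc (cexp z - (1 + m%:R^-1 * z) ^+ m) <= d.
Proof.
move=> d0.
pose C := 6 * B ^+ 2 * expR B / d.
(* [2 * B] ensures |z/m| <= 1/2 and [C] a final error of at most [d]. The absolute values are there
   because [0 <= B] is known only once some [z] is given. *)
pose m := (Num.truncn (`|2 * B| + `|C|)).+1.
have hm : `|2 * B| + `|C| < m%:R by rewrite /m truncnS_gt.
have m0 : (0 : R) < m%:R by rewrite ltr0n.
exists m => z zB.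
have B0 : 0 <= B by apply: le_trans (normc_ge0 z) zB.
rewrite (ger0_norm (_ : 0 <= 2 * B)) in hm; last lra.
have C0 : 0 <= C.
  rewrite /C !mulr_ge0 ?invr_ge0 ?expR_ge0 ?sqr_ge0//; lra.
rewrite (ger0_norm C0) in hm.
set w := m%:R^-1 * z.
have nm : normc (m%:R^-1 : R[i]) = m%:R^-1.
  by rewrite -(rmorph_nat (real_complex R)) -fmorphV normc_real ger0_norm// invr_ge0 ltW.
have wE : normc w = normc z / m%:R by rewrite /w normcM nm mulrC.
have zE : z = w *+ m.
  rewrite /w -[RHS]mulr_natl mulVKf// pnatr_eq0//.
rewrite {1}zE cexpMn.
have hw : normc w <= 2^-1 by rewrite wE ler_pdivrMr//; lra.
have M1 : 1 <= expR (normc w).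
  by rewrite -expR0 ler_expR normc_ge0.
have hz1 : normc (cexp w) <= expR (normc w).
  by rewrite normc_cexp ler_expR (le_trans (ler_norm _))// norm_Re_le.
have hz2 : normc (1 + w) <= expR (normc w).
  by rewrite (le_trans (le_normcD _ _))// normc1 expR_ge1Dx.
apply: le_trans (normc_subX_le m M1 hz1 hz2) _.
rewrite -expRM_natl.
have -> : m%:R * normc w = normc z by rewrite wE mulrC divfK// gt_eqF.
have -> : cexp w - (1 + w) = cexp w - 1 - w by rewrite opprD addrA.
have h1 : m%:R * normc (cexp w - 1 - w) <= 6 * B ^+ 2 / m%:R.
  apply: (@le_trans _ _ (m%:R * (6 * normc w ^+ 2))).
    by rewrite ler_pM2l// normc_cexpB1B.
  rewrite wE expr_div_n [leLHS](_ : _ = 6 * normc z ^+ 2 / m%:R); last first.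
    by field; rewrite gt_eqF.
  rewrite ler_pM2r ?invr_gt0// ler_pM2l// ler_sqr ?nnegrE ?normc_ge0//.
apply: (@le_trans _ _ (6 * B ^+ 2 / m%:R * expR B)).
  apply: ler_pM => //; rewrite ?ler_expR ?expR_ge0//.
  by rewrite mulr_ge0 ?normc_ge0// ler0n.
rewrite -mulrAC ler_pdivrMr//.
have : C * d <= m%:R * d by rewrite ler_pM2r//; lra.
rewrite /C divfK ?gt_eqF//; lra.
Qed.

End ExponentialApproximation.

(** * Means along vertical lines and Fourier-Bohr coefficients *)

Section Means.
Variable R : realType.
Implicit Types (z s a b : R[i]) (x y w t sigma : R) (F G : R[i] -> R[i]).

Definition dexp x s : R[i] := cexp (- (x%:C * s)).

Lemma dexpD x y s : dexp (x + y) s = dexp x s * dexp y s.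
Proof. by rewrite /dexp -cexpD rmorphD /= mulrDl opprD. Qed.

Lemma dexp_addr x s z : dexp x (s + z) = dexp x s * dexp x z.
Proof. by rewrite /dexp -cexpD mulrDr opprD. Qed.

Lemma dexp0 s : dexp 0 s = 1.
Proof. by rewrite /dexp mul0r oppr0 cexp0. Qed.

Lemma normc_dexp x s : normc (dexp x s) = expR (- (x * complex.Re s)).
Proof. by rewrite /dexp normc_cexp; case: s => a b /=; rewrite mul0r subr0. Qed.

Lemma dexpN x s : dexp (- x) s * dexp x s = 1.
Proof. by rewrite -dexpD addNr dexp0. Qed.

(* A Riemann sum over [0, n + 1] with step 1/(n + 1): the range tends to
   infinity while the step tends to 0, so no two frequencies are aliased in the
   limit. *)
Definition avg (V : numFieldType) (f : R -> V) (n : nat) : V :=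
  (n.+1 ^ 2)%:R^-1 * \sum_(k < n.+1 ^ 2) f (k%:R / n.+1%:R).

Lemma avgD (V : numFieldType) (f g : R -> V) :
  avg (fun t => f t + g t) = avg f + avg g.
Proof. by apply/funext => n; rewrite /avg big_split mulrDr. Qed.

Lemma avgZ (V : numFieldType) (a : V) (f : R -> V) :
  avg (fun t => a * f t) = fun n => a * avg f n.
Proof. by apply/funext => n; rewrite /avg -mulr_sumr mulrCA. Qed.

Lemma avgZE (V : numFieldType) (a : V) (f : R -> V) n :
  avg (fun t => a * f t) n = a * avg f n.
Proof. by rewrite avgZ. Qed.

Lemma avg_cst (V : numFieldType) (a : V) : avg (fun=> a) = cst a.
Proof.
by apply/funext => n; rewrite /avg sumr_const card_ord -[a *+ _]mulr_natl mulKf//.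
Qed.

Lemma avg_le (f g : R -> R) n : (forall t, f t <= g t) -> avg f n <= avg g n.
Proof.
move=> fg; rewrite /avg ler_pM2l ?invr_gt0 ?ltr0n ?expn_gt0//.
by apply: ler_sum => k _.
Qed.

Lemma natc_real n : n%:R = (n%:R : R)%:C :> R[i].
Proof. by rewrite rmorph_nat. Qed.

Lemma natcV_real n : n%:R^-1 = (n%:R^-1 : R)%:C :> R[i].
Proof. by rewrite natc_real fmorphV. Qed.

Lemma Re_avg (f : R -> R[i]) n :
  complex.Re (avg f n) = avg (fun t => complex.Re (f t)) n.
Proof.
rewrite /avg natcV_real; set S := \sum_(k < _) f _.
have -> : complex.Re ((((n.+1 ^ 2)%:R : R)^-1)%:C * S) =
    (n.+1 ^ 2)%:R^-1 * complex.Re S by case: (S) => a b /=; rewrite mul0r subr0.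
congr (_ * _); rewrite /S.
by apply: (big_morph (@complex.Re R)) => // -[a b] [c d].
Qed.

Lemma normc_avg (f : R -> R[i]) n :
  normc (avg f n) <= avg (fun t => normc (f t)) n.
Proof.
rewrite /avg normcM natcV_real normc_real ger0_norm ?invr_ge0//.
by rewrite ler_pM2l ?invr_gt0 ?ltr0n ?expn_gt0// normc_sum.
Qed.

Lemma normc_avg_le (f : R -> R[i]) (B : R) n :
  (forall t, normc (f t) <= B) -> normc (avg f n) <= B.
Proof.
move=> h; apply: le_trans (normc_avg _ _) _.
by apply: le_trans (avg_le _ h) _; rewrite avg_cst.
Qed.

(** With N = n + 1, the values are powers of w = e^(-ix/N), and their geometric sum is at most 2/|w
    - 1|. The condition on [x] puts x/N in [-1, 1], where |sin v| >= |v|/2, hence |w - 1| >=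
    |x|/(2N). *)
Lemma normc_avg_dexp x n : x != 0 -> `|x| <= n.+1%:R ->
  normc (avg (fun t => dexp x (0 +i* t)) n) <= 4 / `|x| / n.+1%:R.
Proof.
move=> x0 xn; set N : R := n.+1%:R.
have N0 : 0 < N by rewrite /N ltr0n.
have ax0 : 0 < `|x| by rewrite normr_gt0.
pose w := dexp x (0 +i* N^-1).
have wk k : dexp x (0 +i* (k%:R / N)) = w ^+ k.
  rewrite /w /dexp -cexpMn mulNrn -mulrnAr; congr (cexp (- (_ * _))).
  rewrite -[RHS]mulr_natl natc_real; apply/eqP; rewrite eq_complex /=.
  by apply/andP; split; apply/eqP; ring.
have ReV (t : R) : complex.Re (0 +i* t) = 0 by [].
have nw : normc w = 1 by rewrite /w normc_dexp /= mulr0 oppr0 expR0.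
have hs : `|x| / (2 * N) <= normc (w - 1).
  apply: le_trans (norm_Im_le _).
  have -> : complex.Im (w - 1) = - sin (x / N).
    have -> : w = cexp (0 +i* (- (x / N))).
      rewrite /w /dexp; congr (cexp _); apply/eqP; rewrite eq_complex /=.
      by apply/andP; split; apply/eqP; ring.
    by rewrite /cexp /= expR0 sinN; ring.
  rewrite normrN; set v := x / N.
  have -> : `|x| / (2 * N) = `|v| / 2.
    by rewrite /v normrM normfV (gtr0_norm N0); field; rewrite gt_eqF.
  have v1 : `|v| <= 1 by rewrite /v normrM normfV (gtr0_norm N0) ler_pdivrMr// mul1r.
  have := norm_sinB_le v1; rewrite distrC => h.
  have := ler_normD (v - sin v) (sin v); rewrite subrK => h1.
  have : v ^+ 2 <= `|v| by rewrite -(@real_normK _ v) ?num_real// expr2 ler_piMr.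
  lra.
rewrite /avg; under eq_bigr do rewrite wk.
have E : (w - 1) * \sum_(i < n.+1 ^ 2) w ^+ i = w ^+ (n.+1 ^ 2) - 1.
  by rewrite subrX1.
have : normc (w - 1) * normc (\sum_(i < n.+1 ^ 2) w ^+ i) <= 2.
  rewrite -normcM E (le_trans (le_normcD _ _))// normcN normc1 normcX nw expr1n; lra.
rewrite normcM natcV_real normc_real ger0_norm ?invr_ge0//.
move: (normc (\sum_(i < _) _)) (normc_ge0 (\sum_(i < n.+1 ^ 2) w ^+ i)) => S S0 hS.
have : `|x| / (2 * N) * S <= 2 by apply: le_trans hS; rewrite ler_wpM2r.
rewrite natrX -/N => h.
rewrite mulrC ler_pdivrMr ?exprn_gt0//.
have -> : 4 / `|x| / N * N ^+ 2 = 2 * (2 * N / `|x|) by field; rewrite !gt_eqF.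
by rewrite -ler_pdivrMr ?divr_gt0 ?mulr_gt0// invf_div mulrC.
Qed.

Lemma avg_dexp x sigma :
  avg (fun t => dexp x (sigma +i* t)) @ \oo --> ((x == 0)%:R : R[i]).
Proof.
have [->|x0] /= := eqVneq x 0.
  have -> : avg (fun t => dexp 0 (sigma +i* t)) = cst 1.
    by rewrite -avg_cst; congr (avg _); apply/funext => t; rewrite dexp0.
  exact: cvg_cst.
have -> : avg (fun t => dexp x (sigma +i* t)) =
    fun n => dexp x sigma%:C * avg (fun t => dexp x (0 +i* t)) n.
  rewrite -avgZ; congr (avg _); apply/funext => t; rewrite -dexp_addr.
  by congr (dexp _ _); apply/eqP; rewrite eq_complex /= addr0 add0r !eqxx.
apply/cvgcP => e e0.
pose C := normc (dexp x sigma%:C) * (4 / `|x|).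
have ax0 : 0 < `|x| by rewrite normr_gt0.
have C0 : 0 <= C by rewrite mulr_ge0 ?normc_ge0// divr_ge0// ltW.
near=> n.
rewrite sub0r normcN normcM.
apply: (@le_trans _ _ (C / n.+1%:R)).
  rewrite /C -mulrA ler_wpM2l ?normc_ge0// normc_avg_dexp//.
  near: n; exists (Num.truncn `|x|).+1 => // n /= hn.
  apply: (@le_trans _ _ (Num.truncn `|x|).+1%:R); first by rewrite ltW// truncnS_gt.
  by rewrite ler_nat (leq_trans hn).
rewrite ler_pdivrMr// mulrC -ler_pdivrMr//.
near: n; exists (Num.truncn (C / e)).+1 => // n /= hn.
apply: (@le_trans _ _ (Num.truncn (C / e)).+1%:R); first by rewrite ltW// truncnS_gt.
by rewrite ler_nat (leq_trans hn).
Unshelve. all: by end_near. Qed.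

(** Its limit is the Fourier-Bohr coefficient of [F] at frequency [w]. Multiplying by e^(ws) with
    the full s, not just by its oscillating part, makes this limit the same on every line. *)
Definition coefmean (F : R[i] -> R[i]) sigma w :=
  avg (fun t => F (sigma +i* t) * dexp (- w) (sigma +i* t)).

Lemma coefmeanD F G sigma w :
  coefmean (fun s => F s + G s) sigma w = coefmean F sigma w + coefmean G sigma w.
Proof.
rewrite /coefmean -avgD; congr (avg _).
by apply/funext => t; rewrite mulrDl.
Qed.

Lemma coefmeanZ a F sigma w :
  coefmean (fun s => a * F s) sigma w = fun n => a * coefmean F sigma w n.
Proof.
rewrite -(avgZ a (fun t => F (sigma +i* t) * dexp (- w) (sigma +i* t))).
by rewrite /coefmean; congr (avg _); apply/funext => t; rewrite -mulrA.
Qed.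

Lemma coefmean_dexp x sigma w :
  coefmean (dexp x) sigma w @ \oo --> ((x == w)%:R : R[i]).
Proof.
rewrite -subr_eq0.
have -> : coefmean (dexp x) sigma w = avg (fun t => dexp (x - w) (sigma +i* t)).
  by rewrite /coefmean; congr (avg _); apply/funext => t; rewrite -dexpD.
exact: avg_dexp.
Qed.

Lemma coefmean_cvgD F G sigma w a b :
  coefmean F sigma w @ \oo --> a -> coefmean G sigma w @ \oo --> b ->
  coefmean (fun s => F s + G s) sigma w @ \oo --> a + b.
Proof. by move=> h1 h2; rewrite coefmeanD; exact: (cvgD h1 h2). Qed.

Lemma coefmean_cvgZ k F sigma w a : coefmean F sigma w @ \oo --> a ->
  coefmean (fun s => k * F s) sigma w @ \oo --> k * a.
Proof. by move=> h; rewrite coefmeanZ; exact: (cvgM (cvg_cst k) h). Qed.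

Lemma coefmean_cvgB F G sigma w a b :
  coefmean F sigma w @ \oo --> a -> coefmean G sigma w @ \oo --> b ->
  coefmean (fun s => F s - G s) sigma w @ \oo --> a - b.
Proof.
move=> h1 h2; have h := coefmean_cvgD h1 (@coefmean_cvgZ (-1) _ _ _ _ h2).
rewrite mulN1r in h; rewrite (_ : (fun s => _) = (fun s => F s + (-1) * G s))//.
by apply/funext => s; rewrite mulN1r.
Qed.

Lemma coefmean_dist F G sigma w (d : R) n :
  (forall t, normc (F (sigma +i* t) - G (sigma +i* t)) <= d) ->
  normc (coefmean F sigma w n - coefmean G sigma w n) <= d * expR (w * sigma).
Proof.
move=> h; have -> : coefmean F sigma w n - coefmean G sigma w n =
    coefmean (fun s => F s + (-1) * G s) sigma w n.
  by rewrite coefmeanD coefmeanZ [RHS]/(_ + _) /= mulN1r.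
apply: normc_avg_le => t; rewrite normcM (normc_dexp (- w)) /= (mulNr w) opprK mulN1r.
by rewrite ler_wpM2r ?expR_ge0.
Qed.

End Means.

(** * Uniform limits of exponential sums with prescribed frequencies *)

Section AlmostPeriodic.
Variable R : realType.
Implicit Types (z s a b : R[i]) (x y w t sigma eps d : R).
Implicit Types (F G p q : R[i] -> R[i]) (X Y Z : set R).

(** The frequency set [X] is carried along because coefficients vanish outside it, and this survives
    uniform limits. *)
Inductive dpoly X : (R[i] -> R[i]) -> Prop :=
| dpoly0 : dpoly X (fun=> 0)
| dpolyD b x p : X x -> dpoly X p -> dpoly X (fun s => b * dexp x s + p s).

Lemma dpoly_add X p q : dpoly X p -> dpoly X q -> dpoly X (fun s => p s + q s).
Proof.
move=> hp hq; elim: hp => [|b x p' Xx _ IH].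
  by under eq_fun do rewrite add0r.
by under eq_fun do rewrite -addrA; exact: dpolyD.
Qed.

Lemma dpoly_dexp X x : X x -> dpoly X (dexp x).
Proof.
move=> Xx; have -> : dexp x = (fun s => 1 * dexp x s + 0).
  by apply/funext => s; rewrite mul1r addr0.
by apply: dpolyD => //; exact: dpoly0.
Qed.

Lemma dpoly_mono X Y b x q : (forall y, X y -> Y (x + y)) ->
  dpoly X q -> dpoly Y (fun s => b * dexp x s * q s).
Proof.
move=> h; elim=> [|c y q' Xy _ IH].
  under eq_fun do rewrite mulr0; exact: dpoly0.
have -> : (fun s => b * dexp x s * (c * dexp y s + q' s)) =
    (fun s => (b * c) * dexp (x + y) s + b * dexp x s * q' s).
  by apply/funext => s; rewrite dexpD; ring.
by apply: dpolyD => //; exact: h.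
Qed.

Lemma dpoly_mul X Y Z p q : (forall x y, X x -> Y y -> Z (x + y)) ->
  dpoly X p -> dpoly Y q -> dpoly Z (fun s => p s * q s).
Proof.
move=> h hp hq; elim: hp => [|b x p' Xx _ IH].
  under eq_fun do rewrite mul0r; exact: dpoly0.
under eq_fun do rewrite mulrDl.
by apply: dpoly_add => //; apply: dpoly_mono hq => y; exact: h.
Qed.

Lemma dpoly_bounded X eps p : 0 <= eps -> (forall x, X x -> 0 <= x) ->
  dpoly X p -> exists B, forall s, halfplane eps s -> normc (p s) <= B.
Proof.
move=> eps0 X0; elim=> [|b x q Xx _ [B hB]].
  by exists 0 => s _; rewrite normc0.
exists (normc b + B) => s hs; apply: le_trans (le_normcD _ _) _.
apply: lerD; last exact: hB.
rewrite normcM normc_dexp ler_piMr ?normc_ge0// expR_le1 oppr_le0 mulr_ge0 ?(X0 x)//.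
by rewrite (le_trans eps0)// ltW.
Qed.

Lemma dpoly_coef X p w : dpoly X p -> exists a, (~ X w -> a = 0) /\
  forall sigma, coefmean p sigma w @ \oo --> a.
Proof.
elim=> [|b x q Xx _ [a [a0 ha]]].
  exists 0; split=> // sigma; rewrite (_ : coefmean _ _ _ = cst 0); first exact: cvg_cst.
  by rewrite /coefmean -(avg_cst R); congr (avg _); apply/funext => t; rewrite mul0r.
exists (b * (x == w)%:R + a); split.
  move=> Xw; rewrite a0// addr0; case: eqVneq => [xw|_]; last by rewrite mulr0.
  by rewrite xw in Xx.
move=> sigma; apply: coefmean_cvgD => //; apply: coefmean_cvgZ.
exact: coefmean_dexp.
Qed.

Definition ulim_dpoly X eps F := forall d, 0 < d -> exists2 p, dpoly X p &
  forall s, halfplane eps s -> normc (F s - p s) <= d.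

Lemma ulim_dpoly_ext X eps F G : (forall s, halfplane eps s -> F s = G s) ->
  ulim_dpoly X eps F -> ulim_dpoly X eps G.
Proof.
move=> FG h d d0; have [p hp hd] := h d d0; exists p => // s hs.
by rewrite -FG// hd.
Qed.

Lemma dpoly_ulim X eps p : dpoly X p -> ulim_dpoly X eps p.
Proof. by move=> hp d d0; exists p => // s _; rewrite subrr normc0 ltW. Qed.

Lemma ulim_dpoly_closed X eps F :
  (forall d, 0 < d -> exists2 G, ulim_dpoly X eps G &
     forall s, halfplane eps s -> normc (F s - G s) <= d) ->
  ulim_dpoly X eps F.
Proof.
move=> h d d0; have d2 : 0 < d / 2 by lra.
have [G hG FG] := h _ d2; have [p hp Gp] := hG _ d2.
exists p => // s hs; apply: le_trans (normc_tri (G s) _ _) _.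
by have := FG s hs; have := Gp s hs; lra.
Qed.

Lemma ulim_dpolyD X eps F G : ulim_dpoly X eps F -> ulim_dpoly X eps G ->
  ulim_dpoly X eps (fun s => F s + G s).
Proof.
move=> hF hG d d0; have d2 : 0 < d / 2 by lra.
have [p hp Fp] := hF _ d2; have [q hq Gq] := hG _ d2.
exists (fun s => p s + q s); first exact: dpoly_add.
move=> s hs; rewrite opprD addrACA; apply: le_trans (le_normcD _ _) _.
by have := Fp s hs; have := Gq s hs; lra.
Qed.

Lemma ulim_dpoly_bounded X eps F : 0 <= eps -> (forall x, X x -> 0 <= x) ->
  ulim_dpoly X eps F ->
  exists2 B, 0 < B & forall s, halfplane eps s -> normc (F s) <= B.
Proof.
move=> eps0 X0 h; have [p hp Fp] := h 1 ltr01.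
have [B hB] := dpoly_bounded eps0 X0 hp.
exists (`|B| + 1); first by rewrite ltr_wpDl.
move=> s hs; have := le_normcD (F s - p s) (p s); rewrite subrK.
by have := hB s hs; have := Fp s hs; have := ler_norm B; lra.
Qed.

(** In FG - pq = F (G - q) + (F - p) q, [q] is chosen first, from a bound on [F], and then [p] from
    a bound on that [q]. *)
Lemma ulim_dpolyM X Y Z eps F G : 0 <= eps ->
  (forall x, X x -> 0 <= x) -> (forall x, Y x -> 0 <= x) ->
  (forall x y, X x -> Y y -> Z (x + y)) ->
  ulim_dpoly X eps F -> ulim_dpoly Y eps G ->
  ulim_dpoly Z eps (fun s => F s * G s).
Proof.
move=> eps0 X0 Y0 XYZ hF hG d d0.
have [A A0 hA] := ulim_dpoly_bounded eps0 X0 hF.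
have [q hq Gq] := hG (d / 2 / A) (divr_gt0 (divr_gt0 d0 (ltr0n _ 2)) A0).
have [B B0 hB] := ulim_dpoly_bounded eps0 Y0 (dpoly_ulim eps hq).
have [p hp Fp] := hF (d / 2 / B) (divr_gt0 (divr_gt0 d0 (ltr0n _ 2)) B0).
exists (fun s => p s * q s); first exact: dpoly_mul hp hq.
move=> s hs.
have -> : F s * G s - p s * q s = F s * (G s - q s) + (F s - p s) * q s by ring.
apply: le_trans (le_normcD _ _) _; rewrite !normcM [leRHS](_ : d =
  A * (d / 2 / A) + d / 2 / B * B); last by field; rewrite !gt_eqF.
by apply: lerD; apply: ler_pM; rewrite ?normc_ge0 ?hA ?hB ?Fp ?Gq.
Qed.

Lemma ulim_dpolyX X eps F n : 0 <= eps -> X 0 ->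
  (forall x, X x -> 0 <= x) -> (forall x y, X x -> X y -> X (x + y)) ->
  ulim_dpoly X eps F -> ulim_dpoly X eps (fun s => F s ^+ n).
Proof.
move=> eps0 X0 Xge0 XD hF; elim: n => [|n IH].
  apply: (@ulim_dpoly_ext _ _ (dexp 0)) => [s _|]; first by rewrite dexp0.
  by apply: dpoly_ulim; exact: dpoly_dexp.
under eq_fun do rewrite exprS.
exact: (ulim_dpolyM eps0 Xge0 Xge0 XD).
Qed.

Lemma ulim_dpolyZ X eps b F :
  ulim_dpoly X eps F -> ulim_dpoly X eps (fun s => b * F s).
Proof.
move=> hF d d0; have c0 : 0 < normc b + 1 by rewrite ltr_wpDl ?normc_ge0.
have [p hp Fp] := hF (d / (normc b + 1)) (divr_gt0 d0 c0).
exists (fun s => b * dexp 0 s * p s); first by apply: dpoly_mono hp => y; rewrite add0r.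
move=> s hs; rewrite dexp0 mulr1 -mulrBr normcM.
apply: (@le_trans _ _ ((normc b + 1) * (d / (normc b + 1)))).
  by apply: ler_pM; rewrite ?normc_ge0 ?Fp//; lra.
by rewrite mulrC divfK// gt_eqF.
Qed.

(** [X] is closed under addition and contains 0, so (1 + F/m)^m keeps its frequencies in [X]; their
    nonnegativity makes [F] bounded. *)
Lemma ulim_dpoly_cexp X eps F : 0 <= eps -> X 0 ->
  (forall x, X x -> 0 <= x) -> (forall x y, X x -> X y -> X (x + y)) ->
  ulim_dpoly X eps F -> ulim_dpoly X eps (fun s => cexp (F s)).
Proof.
move=> eps0 X0 Xge0 XD hF; apply: ulim_dpoly_closed => d d0.
have [B _ hB] := ulim_dpoly_bounded eps0 Xge0 hF.
have [m hm] := cexp_uniform_approx B d0.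
exists (fun s => (1 + m%:R^-1 * F s) ^+ m); last by move=> s hs; exact/hm/hB.
apply: ulim_dpolyX => //; apply: ulim_dpolyD; last exact: ulim_dpolyZ.
apply: (@ulim_dpoly_ext _ _ (dexp 0)) => [s _|]; first by rewrite dexp0.
by apply: dpoly_ulim; exact: dpoly_dexp.
Qed.

(** A uniform error d changes the means on the line [sigma] by at most d e^(w sigma). The
    coefficients of the approximants thus form a Cauchy sequence, and since they do not depend on
    [sigma], neither does their limit. *)
Lemma ulim_dpoly_coef X eps F w : ulim_dpoly X eps F ->
  exists a, (~ X w -> a = 0) /\
    forall sigma, eps < sigma -> coefmean F sigma w @ \oo --> a.
Proof.
move=> hF.
have dk k : (0 : R) < k.+1%:R^-1 by rewrite invr_gt0 ltr0n.
pose pk k := sval (cid2 (hF _ (dk k))).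
have hpk k : dpoly X (pk k) /\
    forall s, halfplane eps s -> normc (F s - pk k s) <= k.+1%:R^-1.
  by rewrite /pk; case: cid2 => p h1 h2.
pose ak k := sval (cid (dpoly_coef w (hpk k).1)).
have hak k : (~ X w -> ak k = 0) /\
    forall sigma, coefmean (pk k) sigma w @ \oo --> ak k.
  by rewrite /ak; case: cid.
have small (C e : R) : 0 < e -> exists N, forall k, (N <= k)%N -> k.+1%:R^-1 * C <= e.
  move=> e0; exists (Num.truncn (C / e)) => k hk; rewrite mulrC ler_pdivrMr ?ltr0n//.
  rewrite mulrC -ler_pdivrMr//; apply: ltW; apply: lt_le_trans (truncnS_gt _) _.
  by rewrite ler_nat ltnS.
have dist k sigma n : eps < sigma ->
    normc (coefmean F sigma w n - coefmean (pk k) sigma w n) <=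
    k.+1%:R^-1 * expR (w * sigma).
  by move=> hs; apply: coefmean_dist => t; apply: (hpk k).2.
have [a ha] : exists a, ak @ \oo --> a.
  apply: cvgc_cauchy => e e0.
  (* One line suffices to compare the [ak], here Re s = eps + 1. Two quarters of [e] pay for
     replacing [ak] by means, two for passing through [F]. *)
  have [N hN] := small (expR (w * (eps + 1))) (e / 4) ltac:(lra).
  exists N => k l hk hl.
  have e4 : 0 < e / 4 by lra.
  have /cvgcP/(_ _ e4) h1 := (hak k).2 (eps + 1).
  have /cvgcP/(_ _ e4) h2 := (hak l).2 (eps + 1).
  have [n [n1 n2]] := filter_ex (filterI h1 h2); rewrite /= in n1 n2.
  have hs : eps < eps + 1 by lra.
  have := le_trans (dist k _ n hs) (hN _ hk).
  have := le_trans (dist l _ n hs) (hN _ hl).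
  have := normc_tri (coefmean (pk k) (eps + 1) w n) (ak k) (ak l).
  have := normc_tri (coefmean (pk l) (eps + 1) w n) (coefmean (pk k) (eps + 1) w n) (ak l).
  have := normc_tri (coefmean F (eps + 1) w n) (coefmean (pk k) (eps + 1) w n)
    (coefmean (pk l) (eps + 1) w n).
  rewrite (normcBC (coefmean (pk k) _ _ _) (coefmean F _ _ _)).
  rewrite (normcBC (coefmean (pk l) _ _ _) (ak l)).
  lra.
exists a; split.
  move=> Xw; apply: cvgc_unique ha _; rewrite (_ : ak = cst 0); first exact: cvg_cst.
  by apply/funext => k; rewrite (hak k).1.
move=> sigma hs; apply/cvgcP => e e0; have e3 : 0 < e / 3 by lra.
have [N hN] := small (expR (w * sigma)) _ e3.
move/cvgcP : ha => /(_ _ e3) [M _ hM].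
pose k := maxn N M.
have h1 := hN k (leq_maxl _ _); have h2 := hM k (leq_maxr N M).
have /cvgcP/(_ _ e3) := (hak k).2 sigma; apply: filterS => n h3.
have := le_trans (dist k _ n hs) h1.
have := normc_tri (ak k) a (coefmean F sigma w n).
have := normc_tri (coefmean (pk k) sigma w n) (ak k) (coefmean F sigma w n).
rewrite (normcBC (coefmean (pk k) _ _ _) (coefmean F _ _ _)) /= in h2 *.
lra.
Qed.

End AlmostPeriodic.

(** * Mean squares and Bessel's inequality *)

Section MeanSquare.
Variable R : realType.
Implicit Types (z s a b : R[i]) (x y w t sigma eps d : R).
Implicit Types (F G : R[i] -> R[i]) (l : nat -> R).

Lemma sqr_normcD z s : normc (z + s) ^+ 2 =
  normc z ^+ 2 + normc s ^+ 2 + 2 * complex.Re (z^* * s).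
Proof. by rewrite !sqr_normc; case: z => a b; case: s => c d /=; ring. Qed.

Lemma avg_sqrD a (H : R -> R[i]) n :
  avg (fun t => normc (a + H t) ^+ 2) n =
  normc a ^+ 2 + avg (fun t => normc (H t) ^+ 2) n +
  2 * complex.Re (a^* * avg H n).
Proof.
under [in LHS]eq_fun do rewrite sqr_normcD.
rewrite (avgD (fun t => normc a ^+ 2 + normc (H t) ^+ 2)
  (fun t => 2 * complex.Re (a^* * H t))).
rewrite (avgD (fun=> normc a ^+ 2)) avg_cst [LHS]/(_ + _) /=; congr (_ + _).
rewrite (avgZ 2 (fun t => complex.Re (a^* * H t))) /=; congr (2 * _).
by rewrite -(Re_avg (fun t => a^* * H t)) avgZ.
Qed.

Lemma near_Re_small a (c : nat -> R[i]) eps : 0 < eps -> c @ \oo --> (0 : R[i]) ->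
  \forall n \near \oo, `|2 * complex.Re (a * c n)| <= eps.
Proof.
move=> eps0 hc.
have hac : (fun n => a * c n) @ \oo --> a * (0 : R[i]).
  exact: (cvgM (cvg_cst a) hc).
have e2 : 0 < eps / 2 by lra.
rewrite mulr0 in hac; move/cvgcP : hac => /(_ _ e2); apply: filterS => n.
rewrite sub0r normcN normrM ger0_norm// => h.
by have := norm_Re_le (a * c n); lra.
Qed.

Lemma avg_sum_cvg0 (c : nat -> R[i]) (f : nat -> R -> R[i]) m :
  (forall i, avg (f i) @ \oo --> (0 : R[i])) ->
  avg (fun t => \sum_(i < m) c i * f i t) @ \oo --> (0 : R[i]).
Proof.
move=> hf; elim: m => [|m IH].
  under eq_fun do rewrite big_ord0.
  by rewrite avg_cst; exact: cvg_cst.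
under eq_fun do rewrite big_ord_recr /=.
rewrite (avgD (fun t => \sum_(i < m) c i * f i t)) (avgZ (c m) (f m)).
have h := cvgD IH (cvgM (cvg_cst (c m)) (hf m)).
by rewrite mulr0 addr0 in h; exact: h.
Qed.

(* Horner's scheme. The tail [S_k] of the sum, divided by [e^(-l_k u)], is
   [a_k + e^(-(l_(k+1) - l_k) u) S_(k+1)]: the two summands are orthogonal
   in mean, and the exponential factor is at most 1 in modulus. *)
Lemma avg_sqr_exp_sum_tail (u : R -> R[i]) l (c : nat -> R[i]) m k eps :
  (forall t, 0 <= complex.Re (u t)) ->
  (forall y, 0 < y -> avg (fun t => dexp y (u t)) @ \oo --> (0 : R[i])) ->
  increasing_seq l -> 0 < eps ->
  \forall n \near \oo,
    avg (fun t => normc (\sum_(i < m) c (k + i)%N *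
           dexp (l (k + i)%N - l k) (u t)) ^+ 2) n <=
    \sum_(i < m) normc (c (k + i)%N) ^+ 2 + eps.
Proof.
move=> u0 hu linc; elim: m k eps => [|m IH] k eps eps0.
  apply: nearW => n; rewrite [leLHS](_ : _ = 0) ?big_ord0 ?add0r ?ltW//.
  under eq_fun do rewrite big_ord0 normc0 expr0n /=.
  by rewrite avg_cst.
have lt i : l k < l (k.+1 + i)%N.
  by rewrite ltNge linc -ltnNge addSn ltnS leq_addr.
pose f i t := dexp (l (k.+1 + i)%N - l k) (u t).
pose H t := \sum_(i < m) c (k.+1 + i)%N * f i t.
have hS t : \sum_(i < m.+1) c (k + i)%N * dexp (l (k + i)%N - l k) (u t)
    = c k + H t.
  rewrite big_ord_recl /= addn0 subrr dexp0 mulr1; congr (_ + _).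
  by apply: eq_bigr => i _; rewrite /f addSn -addnS.
have hH t : normc (H t) ^+ 2 <= normc (\sum_(i < m) c (k.+1 + i)%N *
    dexp (l (k.+1 + i)%N - l k.+1) (u t)) ^+ 2.
  rewrite lerXn2r ?nnegrE ?normc_ge0//.
  have -> : H t = dexp (l k.+1 - l k) (u t) * \sum_(i < m) c (k.+1 + i)%N *
      dexp (l (k.+1 + i)%N - l k.+1) (u t).
    rewrite mulr_sumr; apply: eq_bigr => i _.
    have E : l (k.+1 + i)%N - l k = l k.+1 - l k + (l (k.+1 + i)%N - l k.+1) by ring.
    by rewrite /f E dexpD; ring.
  rewrite normcM ler_piMl ?normc_ge0// normc_dexp expR_le1 oppr_le0 mulr_ge0//.
  by have := lt 0%N; rewrite addn0; lra.
have e2 : 0 < eps / 2 by lra.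
have h0 : avg H @ \oo --> (0 : R[i]).
  apply: (@avg_sum_cvg0 (fun i => c (k.+1 + i)%N)) => i.
  by apply: hu; rewrite subr_gt0.
apply: filterS2 (IH k.+1 _ e2) (near_Re_small (c k)^* e2 h0) => n h1 h2.
under eq_fun do rewrite hS.
rewrite avg_sqrD big_ord_recl /= addn0.
have := le_trans (avg_le n hH) h1.
under [in X in _ -> _ <= X]eq_bigr do rewrite /bump /= addnS -addSn.
move: h2; rewrite ler_norml => /andP[_]; lra.
Qed.

(** Dividing by e^(-xs), whose modulus is constant on the line, turns the cross term into the
    coefficient mean of [H] at [x]. The two summands are orthogonal in mean when this tends to 0. *)
Lemma avg_sqr_orth a x H sigma n :
  let r2 := expR (- (2 * (x * sigma))) in
  avg (fun t => normc (a * dexp x (sigma +i* t) + H (sigma +i* t)) ^+ 2) n =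
  normc a ^+ 2 * r2 + avg (fun t => normc (H (sigma +i* t)) ^+ 2) n +
  r2 * (2 * complex.Re (a^* * coefmean H sigma x n)).
Proof.
move=> r2; have hn t : normc (dexp x (sigma +i* t)) ^+ 2 = r2.
  by rewrite normc_dexp /= -expRM_natl; congr expR; ring.
have hn' t : normc (dexp (- x) (sigma +i* t)) ^+ 2 * r2 = 1.
  by rewrite -(hn t) -exprMn -normcM dexpN normc1 expr1n.
have E t : normc (a * dexp x (sigma +i* t) + H (sigma +i* t)) ^+ 2 =
    r2 * normc (a + H (sigma +i* t) * dexp (- x) (sigma +i* t)) ^+ 2.
  rewrite -(hn t) -exprMn -normcM mulrDr mulrC; congr (normc (_ + _) ^+ _).
  by rewrite mulrCA [_ * dexp (- x) _]mulrC dexpN mulr1.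
under eq_fun do rewrite E.
rewrite (avgZ r2 (fun t => normc (a + H (sigma +i* t) * dexp (- x) (sigma +i* t)) ^+ 2)) /=.
rewrite avg_sqrD !mulrDr [r2 * normc a ^+ 2]mulrC; congr (_ + _ + _).
rewrite -avgZE; congr (avg _ n); apply/funext => t.
by rewrite normcM exprMn mulrCA [r2 * _]mulrC hn' mulr1.
Qed.

(** Keeping the mean square of the remainder in the inequality drives the induction: once the next
    term is removed, the new remainder has coefficient 0 at [l m], so Pythagoras applies up to a
    small error. *)
Lemma bessel_mean F sigma l (c : nat -> R[i]) m eps : injective l ->
  (forall j, coefmean F sigma (l j) @ \oo --> c j) -> 0 < eps ->
  \forall n \near \oo,
    \sum_(j < m) normc (c j) ^+ 2 * expR (- (2 * (l j * sigma))) +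
    avg (fun t => normc (F (sigma +i* t) -
           \sum_(j < m) c j * dexp (l j) (sigma +i* t)) ^+ 2) n <=
    avg (fun t => normc (F (sigma +i* t)) ^+ 2) n + eps.
Proof.
move=> linj hc; elim: m eps => [|m IH] eps eps0.
  apply: nearW => n; rewrite big_ord0 add0r.
  under eq_fun do rewrite big_ord0 subr0.
  by rewrite lerDl ltW.
pose G m s := F s - \sum_(j < m) c j * dexp (l j) s.
have GS s : G m s = c m * dexp (l m) s + G m.+1 s.
  by rewrite /G big_ord_recr /=; ring.
have hG k j : coefmean (G k) sigma (l j) @ \oo --> c j - (if (j < k)%N then c j else 0).
  elim: k => [|k IHk].
    rewrite subr0; have -> : G 0%N = F by apply/funext => s; rewrite /G big_ord0 subr0.
    exact: hc.
  have -> : G k.+1 = fun s => G k s - c k * dexp (l k) s.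
    by apply/funext => s; rewrite /G big_ord_recr /=; ring.
  have -> : c j - (if (j < k.+1)%N then c j else 0) =
      c j - (if (j < k)%N then c j else 0) - c k * (l k == l j)%:R.
    by rewrite (inj_eq linj) ltnS eq_sym; case: (ltngtP j k) => [|_|->]; rewrite /= ?mulr0 ?mulr1 ?subr0//.
  have h := coefmean_cvgB IHk (@coefmean_cvgZ _ (c k) _ _ _ _
    (@coefmean_dexp _ (l k) sigma (l j))).
  exact h.
have hm := hG m.+1 m; rewrite ltnSn subrr in hm.
have e2 : 0 < eps / 2 by lra.
pose r2 := expR (- (2 * (l m * sigma))).
(* The cross term comes multiplied by [r2], which the tolerance has to absorb. *)
have e3 : 0 < eps / 2 / r2 by rewrite divr_gt0 ?expR_gt0.
apply: filterS2 (IH _ e2) (near_Re_small (c m)^* e3 hm) => n h1.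
rewrite -/(G m) in h1.
have -> : (fun t => normc (F (sigma +i* t) - \sum_(j < m.+1) c j * dexp (l j) (sigma +i* t)) ^+ 2) =
  (fun t => normc (G m.+1 (sigma +i* t)) ^+ 2) by [].
move: h1; have -> : (fun t => normc (F (sigma +i* t) - \sum_(j < m) c j * dexp (l j) (sigma +i* t)) ^+ 2) =
  (fun t => normc (c m * dexp (l m) (sigma +i* t) + G m.+1 (sigma +i* t)) ^+ 2).
  by apply/funext => t; rewrite -GS.
rewrite avg_sqr_orth -/r2 big_ord_recr /= -/r2 => h1.
rewrite ler_pdivlMr ?expR_gt0// => h2.
have : - (eps / 2) <= r2 * (2 * complex.Re ((c m)^* * coefmean (G m.+1) sigma (l m) n)).
  apply: le_trans (lerNnormlW (lexx _)).
  by rewrite lerN2 normrM mulrC (gtr0_norm (expR_gt0 _)).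
lra.
Qed.

Lemma avg_ge0 (f : R -> R) n : (forall t, 0 <= f t) -> 0 <= avg f n.
Proof. by move=> f0; have := avg_le n f0; rewrite avg_cst. Qed.

Lemma bessel_coef F sigma l (c : nat -> R[i]) (B : R) m : injective l ->
  (forall j, coefmean F sigma (l j) @ \oo --> c j) ->
  (forall eps, 0 < eps -> \forall n \near \oo,
     avg (fun t => normc (F (sigma +i* t)) ^+ 2) n <= B + eps) ->
  \sum_(j < m) normc (c j) ^+ 2 * expR (- (2 * (l j * sigma))) <= B.
Proof.
move=> linj hc hB; apply/ler_addgt0Pr => eps eps0; have e2 : 0 < eps / 2 by lra.
have [n [h1 h2]] := filter_ex (filterI (bessel_mean m linj hc e2) (hB _ e2)).
have : 0 <= avg (fun t => normc (F (sigma +i* t) -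
           \sum_(j < m) c j * dexp (l j) (sigma +i* t)) ^+ 2) n.
  by apply: avg_ge0 => t; exact: sqr_ge0.
rewrite /= in h1 h2; lra.
Qed.

End MeanSquare.

(** * Summing a series with given mean coefficients on Re s > 1/2 *)

Section Representation.
Variable R : realType.
Implicit Types (z s a b : R[i]) (x y w t sigma eps d : R).
Implicit Types (F G p q : R[i] -> R[i]) (X : set R) (l : nat -> R).

(** A discrete integral test: with f i = (i + 1)^(1 - x), the term (i + 2)^(-x) is at most (f i - f
    (i + 1))/(x - 1), because ln (i + 2) - ln (i + 1) >= 1/(i + 2). *)
Lemma sum_expR_ln_le x K : 1 < x ->
  \sum_(i < K) expR (- (x * ln i.+1%:R)) <= 1 + (x - 1)^-1 :> R.
Proof.
move=> x1; have x0 : 0 < x - 1 by lra.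
pose f (i : nat) := expR (- ((x - 1) * ln (i.+1%:R : R))).
have step i : expR (- (x * ln i.+2%:R)) <= (f i - f i.+1) / (x - 1).
  rewrite ler_pdivlMr//.
  have i1 : (0 : R) < i.+1%:R by rewrite ltr0n.
  have i2 : (0 : R) < i.+2%:R by rewrite ltr0n.
  have hln : (i.+2%:R : R)^-1 <= ln i.+2%:R - ln i.+1%:R.
    have -> : ln (i.+2%:R : R) - ln i.+1%:R = - ln (i.+1%:R / i.+2%:R).
      by rewrite ln_div ?posrE// opprB.
    have -> : (i.+1%:R / i.+2%:R : R) = 1 + - (i.+2%:R)^-1.
      have -> : (i.+1%:R : R) = i.+2%:R - 1 by rewrite -[i.+2%:R]natr1 addrK.
      by rewrite mulrBl divff ?gt_eqF// mul1r.
    rewrite lerNr; apply: le_ln1Dx.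
    by rewrite ltrN2 invf_lt1// ltr1n.
  have -> : f i = f i.+1 * expR ((x - 1) * (ln i.+2%:R - ln i.+1%:R)).
    by rewrite /f -expRD; congr expR; ring.
  have -> : expR (- (x * ln i.+2%:R)) = f i.+1 * (i.+2%:R : R)^-1.
    rewrite /f -[X in _ * X^-1](lnK (_ : i.+2%:R \in Num.pos)) ?posrE//.
    by rewrite -expRN -expRD; congr expR; ring.
  have : 1 + (x - 1) * (i.+2%:R)^-1 <= expR ((x - 1) * (ln i.+2%:R - ln i.+1%:R)).
    by apply: le_trans (expR_ge1Dx _); rewrite lerD2l ler_pM2l.
  move: (expR (_ * _)) (i.+2%:R^-1) => A B AB.
  by have := ler_wpM2l (expR_ge0 (- ((x - 1) * ln (i.+2%:R : R)))) AB; rewrite -/(f i.+1); lra.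
(* The telescoped remainder is kept for the induction; [K.-1] because the first term, 1, stands
   outside the telescope. *)
have : \sum_(i < K) expR (- (x * ln i.+1%:R)) <= 1 + (x - 1)^-1 - f K.-1 / (x - 1).
  case: K => [|K].
    by rewrite big_ord0 /f ln1 mulr0 oppr0 expR0 mul1r; lra.
  elim: K => [|K IH].
    by rewrite big_ord1 /f ln1 !mulr0 oppr0 expR0; lra.
  rewrite big_ord_recr /=; have := step K; move: IH => /=; lra.
have : 0 <= f K.-1 / (x - 1) by rewrite divr_ge0 ?expR_ge0// ltW.
lra.
Qed.

Lemma sum_inj_le (h : nat -> R) (P : pred nat) (k : nat -> nat) (C : R) J :
  (forall i, 0 <= h i) ->
  (forall i j, P i -> P j -> k i = k j -> i = j) ->
  (forall K, \sum_(i < K) h i <= C) -> \sum_(j < J | P j) h (k j) <= C.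
Proof.
move=> h0 kinj hC.
pose s := [seq k j | j <- index_iota 0 J & P j].
have us : uniq s.
  rewrite map_inj_in_uniq ?filter_uniq ?iota_uniq// => i j.
  by rewrite !mem_filter => /andP[Pi _] /andP[Pj _]; exact: kinj.
pose K := (\max_(i <- s) i).+1.
apply: le_trans (hC K).
rewrite -(big_mkord P (fun j => h (k j))) -big_filter -(big_map k predT h) -/s.
rewrite -(big_mkord predT h).
have -> : \sum_(i <- s) h i = \sum_(i <- index_iota 0 K | i \in s) h i.
  rewrite -[RHS]big_filter; apply: perm_big; apply: uniq_perm => //.
    by rewrite filter_uniq ?iota_uniq.
  move=> i; rewrite mem_filter mem_index_iota /=.
  case: (boolP (i \in s)) => //= si; rewrite ltnS.
  by symmetry; exact: (@leq_bigmax_seq _ s predT id).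
by rewrite big_mkcond; apply: ler_sum => i _; case: ifP.
Qed.

(** For y = c0 ln lam_n these are the frequencies open to lam_n^(-psi), an ordinary Dirichlet series
    times lam_n^(-c0 s). *)
Definition shifted_logs y : set R := [set y + ln k.+1%:R | k in [set: nat]].

(** The indices summed over correspond to distinct integers k, so the bound for zeta(x) applies;
    over all j the sum may be unbounded. *)
Lemma sum_shifted_logs l y x : injective l -> 0 <= y -> 1 < x ->
  exists2 C, 0 <= C & forall J,
  \sum_(j < J | `[< shifted_logs y (l j) >]) expR (- (x * l j)) <= C.
Proof.
move=> linj y0 x1; exists (1 + (x - 1)^-1).
  by rewrite addr_ge0// invr_ge0; lra.
move=> J.
have hk j : exists k : nat, shifted_logs y (l j) -> l j = y + ln k.+1%:R.
  by have [[k _ <-]|h] := pselect (shifted_logs y (l j)); [exists k|exists 0%N].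
have [k kP] := choice hk.
pose h i := expR (- (x * ln (i.+1%:R : R))).
apply: (@le_trans _ _ (\sum_(j < J | `[< shifted_logs y (l j) >]) h (k j))).
  apply: ler_sum => j /asboolP hj; rewrite /h ler_expR lerN2 ler_pM2l; last lra.
  by rewrite (kP _ hj) lerDr.
apply: (@sum_inj_le h (fun j => `[< shifted_logs y (l j) >])) => [i|i j|K].
- exact: expR_ge0.
- by move=> /asboolP hi /asboolP hj e; apply: linj; rewrite (kP _ hi) (kP _ hj) e.
- exact: sum_expR_ln_le.
Qed.

(** [dpoly] allows repeated frequencies in any order. Rewriting [p] along [l] identifies its
    coefficients with its means and makes the partial sums exact from some index on. *)
Lemma dpoly_expansion X l p : injective l -> X `<=` range l -> dpoly X p ->
  exists (c : nat -> R[i]) J0, [/\ forall j, ~ X (l j) -> c j = 0,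
    forall sigma j, coefmean p sigma (l j) @ \oo --> c j &
    forall J, (J0 <= J)%N -> forall s, p s = \sum_(j < J) c j * dexp (l j) s].
Proof.
move=> linj Xl; elim=> [|b x q Xx _ [c [J0 [c0 hc hq]]]].
  exists (fun=> 0), 0%N; split=> // [sigma j|J _ s].
    rewrite (_ : coefmean _ _ _ = cst 0); first exact: cvg_cst.
    by rewrite /coefmean -(avg_cst R); congr (avg _); apply/funext => t; rewrite mul0r.
  by rewrite big1// => i _; rewrite mul0r.
have [j0 _ lj0] := Xl _ Xx.
exists (fun j => b * (x == l j)%:R + c j), (maxn J0 j0.+1); split=> [j Xj|sigma j|J].
- rewrite c0// addr0; case: eqVneq => [e|_]; last by rewrite mulr0.
  by rewrite -e in Xj.
- exact: (coefmean_cvgD (@coefmean_cvgZ _ b _ _ _ _ (@coefmean_dexp _ x sigma (l j))) (hc sigma j)).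
rewrite geq_max => /andP[h1 h2] s.
rewrite (hq J h1); under [RHS]eq_bigr do rewrite mulrDl.
rewrite big_split /=; congr (_ + _).
rewrite (bigD1 (Ordinal h2))//= -lj0 eqxx mulr1 big1 ?addr0// => i ij.
rewrite (inj_eq linj) eq_sym; move: ij; rewrite -val_eqE /= => /negPf ->.
by rewrite mulr0 mul0r.
Qed.

Lemma avg_sqr_le F sigma d n : 0 <= d ->
  (forall t, normc (F (sigma +i* t)) <= d) ->
  avg (fun t => normc (F (sigma +i* t)) ^+ 2) n <= d ^+ 2.
Proof.
move=> d0 h; rewrite -[leRHS]/(cst (d ^+ 2) n) -(avg_cst R); apply: avg_le => t.
by rewrite lerXn2r ?nnegrE ?normc_ge0.
Qed.

(* Weighted AM-GM, with weight [d]. *)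
Lemma sum_normc_le X l (h : nat -> R[i]) (C : R) d eps x J : 0 < d ->
  (forall j, ~ X (l j) -> h j = 0) ->
  \sum_(j < J) normc (h j) ^+ 2 * expR (- (2 * (l j * eps))) <= d ^+ 2 ->
  \sum_(j < J | `[< X (l j) >]) expR (- (2 * (x - eps) * l j)) <= C ->
  \sum_(j < J) normc (h j) * expR (- (l j * x)) <= d * ((1 + C) / 2).
Proof.
move=> d0 h0 H1 H2.
apply: (@le_trans _ _ (2^-1 * (d^-1 *
   \sum_(j < J) normc (h j) ^+ 2 * expR (- (2 * (l j * eps))) +
   d * \sum_(j < J | `[< X (l j) >]) expR (- (2 * (x - eps) * l j))))).
  rewrite [X in d * X]big_mkcond !mulr_sumr -big_split /= mulr_sumr.
  apply: ler_sum => j _; case: asboolP => [Xj|/h0 ->]; last first.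
    by rewrite normc0 expr0n /= !mul0r !mulr0 addr0 mulr0.
  set A := expR (- (l j * eps)); set B := expR (- ((x - eps) * l j)).
  have -> : expR (- (2 * (l j * eps))) = A ^+ 2.
    by rewrite /A -expRM_natl; congr expR; ring.
  have -> : expR (- (2 * (x - eps) * l j)) = B ^+ 2.
    by rewrite /B -expRM_natl; congr expR; ring.
  have -> : expR (- (l j * x)) = A * B.
    by rewrite /A /B -expRD; congr expR; ring.
  have := mulr_ge0 (ltW d0) (sqr_ge0 (d^-1 * (normc (h j) * A) - B)).
  have -> : d * (d^-1 * (normc (h j) * A) - B) ^+ 2 =
    d^-1 * (normc (h j) ^+ 2 * A ^+ 2) + d * B ^+ 2 - 2 * (normc (h j) * (A * B)).
    by field; rewrite gt_eqF.
  lra.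
have : d^-1 * \sum_(j < J) normc (h j) ^+ 2 * expR (- (2 * (l j * eps))) <= d.
  by rewrite mulrC ler_pdivrMr.
have : d * \sum_(j < J | `[< X (l j) >]) expR (- (2 * (x - eps) * l j)) <= d * C.
  by rewrite ler_pM2l.
lra.
Qed.

(** Bessel on the line Re s = eps bounds the sum of |g_j|^2 e^(-2 eps l_j) by 1, and [sum_normc_le]
    turns this into absolute convergence at s. Applied to p - F, with an exponential sum p uniformly
    close to F, the same estimate controls the gap between the partial sums of the two series, and
    those of p eventually equal p. *)
Lemma represents_of_coef y l F (g : nat -> R[i]) : injective l -> 0 <= y ->
  shifted_logs y `<=` range l ->
  (forall eps, 0 < eps -> ulim_dpoly (shifted_logs y) eps F) ->
  (forall s, halfplane 0 s -> normc (F s) <= 1) ->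
  (forall j, ~ shifted_logs y (l j) -> g j = 0) ->
  (forall sigma j, 0 < sigma -> coefmean F sigma (l j) @ \oo --> g j) ->
  forall s, halfplane 2^-1 s ->
    cvgn (series (fun j => normc (g j * dexp (l j) s))) /\
    series (fun j => g j * dexp (l j) s) @ \oo --> F s.
Proof.
move=> linj y0 Xl hF F1 g0 hg s; rewrite /halfplane /= => hs.
set x := complex.Re s in hs.
(* Then 2 (x - eps) = x + 1/2 > 1, the exponent needed to sum over [shifted_logs y]. *)
pose eps := (x - 2^-1) / 2.
have eps0 : 0 < eps by rewrite /eps; lra.
have [|C C0 hC] := @sum_shifted_logs l y (2 * (x - eps)) linj y0; first by rewrite /eps; lra.
have nE j (a : R[i]) : normc (a * dexp (l j) s) = normc a * expR (- (l j * x)).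
  by rewrite normcM normc_dexp.
split.
  apply: nondecreasing_is_cvgn.
    apply/nondecreasing_seqP => n; rewrite /series /= big_nat_recr//= lerDl.
    exact: normc_ge0.
  exists (1 * ((1 + C) / 2)) => _ [J _ <-]; rewrite /series /= big_mkord.
  under eq_bigr do rewrite nE.
  apply: (@sum_normc_le (shifted_logs y) l g C 1 eps x J) => //.
  rewrite expr1n; apply: (@bessel_coef _ F eps l g 1 J linj) => [j|e e0]; first exact: hg.
  apply: nearW => n; apply: (@le_trans _ _ (1 ^+ 2)); last by rewrite expr1n lerDl ltW.
  by apply: avg_sqr_le => // t; exact: F1.
apply/cvgcP => e e0; pose d := e / (2 + C).
have d0 : 0 < d by rewrite divr_gt0//; lra.
(* With [eps / 2] the line Re s = eps, on which Bessel is used, lies inside the half-plane of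
   approximation. *)
have [|p hp Fp] := hF (eps / 2) _ d d0; first by lra.
have [c [J0 [c0 hc pE]]] := dpoly_expansion linj Xl hp.
exists J0 => // J /= J0J; rewrite /series /= big_mkord.
have -> : F s - \sum_(j < J) g j * dexp (l j) s =
    (F s - p s) + \sum_(j < J) (c j - g j) * dexp (l j) s.
  rewrite (pE J J0J); under [X in _ = _ + X]eq_bigr do rewrite mulrBl.
  by rewrite sumrB; ring.
apply: le_trans (le_normcD _ _) _.
have h1 : normc (F s - p s) <= d by apply: Fp; rewrite /halfplane /= -/x /eps; lra.
have h2 : normc (\sum_(j < J) (c j - g j) * dexp (l j) s) <= d * ((1 + C) / 2).
  apply: le_trans (normc_sum _ _ _) _; under eq_bigr do rewrite nE.
  apply: (@sum_normc_le (shifted_logs y) l (fun j => c j - g j) C d eps x J) => //.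
    by move=> j hj; rewrite c0// g0// subr0.
  apply: (@bessel_coef _ (fun s => p s - F s) _ _ (fun j => c j - g j) _ _ linj).
    by move=> j; apply: coefmean_cvgB; [exact: hc|exact: hg].
  move=> e' e'0; apply: nearW => n.
  apply: (@le_trans _ _ (d ^+ 2)); last by rewrite lerDl ltW.
  apply: (@avg_sqr_le (fun s => p s - F s)); first exact: ltW.
  by move=> t; rewrite normcBC; apply: Fp; rewrite /halfplane /=; lra.
have : d * (2 + C) = e by rewrite /d divfK// gt_eqF//; lra.
have := mulr_ge0 (ltW d0) C0; lra.
Qed.

End Representation.

(** * Uniqueness of the coefficients *)

Section Uniqueness.
Variable R : realType.
Implicit Types (l : nat -> R) (g : nat -> R[i]).

(* The first nonzero coefficient dominates the series as s -> +oo. *)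
Lemma dirichlet_coef_eq0 l g : increasing_seq l ->
  (forall s, halfplane 2^-1 s ->
    cvgn (series (fun j => normc (g j * dexp (l j) s))) /\
    series (fun j => g j * dexp (l j) s) @ \oo --> (0 : R[i])) ->
  forall j, g j = 0.
Proof.
move=> linc h; elim/ltn_ind => m IH.
have hs1 : halfplane 2^-1 (1%:C : R[i]) by rewrite /halfplane /=; lra.
have [hc1 _] := h _ hs1.
have [C hC] : exists C, forall J, \sum_(j < J) normc (g j * dexp (l j) 1%:C) <= C.
  exists (limn (series (fun j => normc (g j * dexp (l j) 1%:C)))) => J.
  rewrite -(big_mkord predT (fun j => normc (g j * dexp (l j) 1%:C))).
  apply: nondecreasing_cvgn_le => //.
  apply/nondecreasing_seqP => n; rewrite /series /= big_nat_recr//= lerDl.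
  exact: normc_ge0.
pose D := l m.+1 - l m.
have D0 : 0 < D by rewrite subr_gt0 ltNge linc -ltnNge.
have C0 : 0 <= C by have := hC 0%N; rewrite big_ord0.
(* Moving from s = 1 to s = 1 + u gains a factor of at most e^(-u l_(m+1)) on every term beyond m,
   but only e^(-u l_m) on term m. *)
have key u : 0 <= u -> normc (g m) * expR (u * D) <= C * expR (l m).
  move=> u0.
  have hs : halfplane 2^-1 ((1 + u)%:C : R[i]) by rewrite /halfplane /=; lra.
  have [_ hl] := h _ hs.
  have tail J : (m < J)%N -> normc (\sum_(j < J) g j * dexp (l j) (1 + u)%:C -
      g m * dexp (l m) (1 + u)%:C) <= C * expR (- (u * l m.+1)).
    move=> mJ; rewrite (bigD1 (Ordinal mJ))//= addrAC subrr add0r.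
    apply: le_trans (normc_sum _ _ _) _.
    apply: (@le_trans _ _ (\sum_(j < J) normc (g j * dexp (l j) 1%:C) * expR (- (u * l m.+1)))).
      rewrite big_mkcond /=; apply: ler_sum => j _; case: ifP => [jm|_]; last first.
        by rewrite mulr_ge0 ?normc_ge0 ?expR_ge0.
      case: (ltnP j m) => [/IH ->|mj]; first by rewrite !mul0r normc0 mul0r.
      have {}mj : (m < j)%N.
        by rewrite ltn_neqAle mj andbT eq_sym; move: jm; rewrite -val_eqE.
      rewrite 2!(normcM (g j)) 2!normc_dexp -mulrA ler_wpM2l ?normc_ge0// -expRD ler_expR /=.
      have : u * l m.+1 <= u * l j by rewrite ler_wpM2l// linc.
      lra.
    by rewrite -mulr_suml ler_wpM2r ?expR_ge0.
  have : normc (g m * dexp (l m) (1 + u)%:C) <= C * expR (- (u * l m.+1)).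
    apply/ler_addgt0Pr => e e0; move/cvgcP : hl => /(_ _ e0) [N _ hN].
    have := hN (maxn N m.+1) (leq_maxl _ _); rewrite /series /= big_mkord.
    have := tail (maxn N m.+1) (leq_maxr _ _).
    set S := \sum_(j < _) _; set T := g m * _ => h1; rewrite sub0r normcN => h2.
    have := le_normcD (T - S) S; rewrite subrK normcBC; lra.
  rewrite normcM normc_dexp /= => H.
  have := ler_wpM2r (expR_ge0 (l m + u * l m.+1)) H.
  rewrite -!mulrA -!expRD.
  have -> : - (l m * (1 + u)) + (l m + u * l m.+1) = u * D by rewrite /D; ring.
  by have -> : - (u * l m.+1) + (l m + u * l m.+1) = l m by ring.
apply: eq0_normc; apply/eqP; rewrite eq_le normc_ge0 andbT leNgt; apply/negP => g0.
(* This makes |g_m| (1 + uD) equal to |g_m| + C e^(l_m), so e^(uD) >= 1 + uD contradicts [key]. *)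
pose u := C * expR (l m) / normc (g m) / D.
have u0 : 0 <= u by rewrite /u divr_ge0 ?(ltW D0)// divr_ge0 ?normc_ge0// mulr_ge0 ?expR_ge0.
have := key u u0; apply/negP; rewrite -ltNge.
apply: (@lt_le_trans _ _ (normc (g m) * (1 + u * D))); last first.
  by rewrite ler_pM2l// expR_ge1Dx.
have -> : normc (g m) * (1 + u * D) = normc (g m) + C * expR (l m).
  by rewrite /u; field; rewrite !gt_eqF.
by rewrite ltrDr.
Qed.

End Uniqueness.

(** * Exponentials of psi and the frequencies they carry *)

Section GordonHedenmalm.
Variable R : realType.
Implicit Types (z s a b : R[i]) (x y w t sigma eps d : R).
Implicit Types (F G psi phi : R[i] -> R[i]) (X : set R) (l lam q : nat -> R).

Lemma shifted_logsD x y u w :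
  shifted_logs x u -> shifted_logs y w -> @shifted_logs R (x + y) (u + w).
Proof.
move=> [j _ <-] [k _ <-]; exists (j.+1 * k.+1).-1 => //.
rewrite prednK// natrM lnM ?posrE ?ltr0n//; ring.
Qed.

Lemma shifted_logs_ge0 y x : 0 <= y -> shifted_logs y x -> 0 <= x.
Proof. by move=> y0 [k _ <-]; rewrite addr_ge0// ln_ge0// ler1n. Qed.

Lemma dpoly_dirichlet_series (c : nat -> R[i]) n :
  dpoly (shifted_logs 0) (dirichlet_series c n).
Proof.
have -> : dirichlet_series c n = fun s => \sum_(i < n) c i * dexp (ln i.+1%:R) s.
  by apply/funext => s; rewrite /dirichlet_series /series /= big_mkord.
elim: n => [|n IH].
  by under eq_fun do rewrite big_ord0; exact: dpoly0.
under eq_fun do rewrite big_ord_recr /= addrC.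
by apply: dpolyD => //; exists n => //; rewrite add0r.
Qed.

Lemma uniform_ulim_dpoly (c : nat -> R[i]) phi eps :
  {uniform halfplane eps, dirichlet_series c @ \oo --> phi} ->
  ulim_dpoly (shifted_logs 0) eps phi.
Proof.
move=> h d d0.
have [N _ hN] : \forall n \near \oo, forall s, halfplane eps s ->
    normc (phi s - dirichlet_series c n s) <= d.
  apply: (h [set f | forall s, halfplane eps s -> normc (phi s - f s) <= d]).
  apply/uniform_nbhs; exists [set xy | normc (xy.1 - xy.2) <= d]; split => //.
  have d0' : (0 : R[i]) < d%:C by rewrite ltcR.
  apply: filterS (entourage_ball _ (PosNum d0')) => -[a b] /=.
  by rewrite -ball_normE /ball_ /= norm_normc ltcR => /ltW.
exists (dirichlet_series c N); first exact: dpoly_dirichlet_series.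
by apply: hN => /=.
Qed.

(** In e^(-y psi) = e^(-y c0 s) e^(-y phi), the second factor keeps its frequencies among the ln k,
    which are closed under addition as integers are under multiplication; the first shifts them by y
    c0. *)
Lemma G_ge1_exp psi : G_ge1 psi -> exists2 c0 : nat, (1 <= c0)%N &
  (forall s, halfplane 0 s -> 0 <= complex.Re (psi s)) /\
  forall y eps, 0 <= y -> 0 < eps ->
    ulim_dpoly (shifted_logs (y * c0%:R)) eps (fun s => dexp y (psi s)).
Proof.
move=> [c0 [c [phi [c01 psiE hphi hRe]]]]; exists c0 => //.
have Rephi s : halfplane 0 s -> 0 <= complex.Re (phi s).
  case: hRe => [h|[tau h]] hs; last by rewrite h.
  by apply: ltW; apply: (h (phi s)); exists s.
split=> [s hs|y eps y0 eps0].
  rewrite psiE// natc_real; have := Rephi s hs; rewrite /halfplane /= in hs.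
  case: s hs (phi s) => a b /= hs [u v] /= hu.
  by rewrite mul0r subr0 addr_ge0// mulr_ge0// ltW.
have e0 : 0 <= eps by exact: ltW.
have hX : ulim_dpoly (shifted_logs 0) eps (fun s => cexp (- y%:C * phi s)).
  apply: ulim_dpoly_cexp => //.
  - by exists 0%N => //; rewrite ln1 addr0.
  - by move=> x; exact: shifted_logs_ge0.
  - by move=> x x' h h'; rewrite -(addr0 (0 : R)); exact: shifted_logsD.
  - by apply: ulim_dpolyZ; apply: uniform_ulim_dpoly (hphi _ eps0).
have hM : ulim_dpoly [set y * c0%:R] eps (dexp (y * c0%:R)).
  by apply: dpoly_ulim; exact: dpoly_dexp.
apply: (@ulim_dpoly_ext _ _ _ (fun s => dexp (y * c0%:R) s * cexp (- y%:C * phi s))).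
  move=> s hs; rewrite /dexp -cexpD psiE; last by rewrite /halfplane /= (lt_trans eps0).
  by congr cexp; rewrite natc_real rmorphM /=; ring.
apply: (ulim_dpolyM e0 _ _ _ hM hX).
- by move=> _ ->; rewrite mulr_ge0.
- by move=> x; exact: shifted_logs_ge0.
- by move=> _ _ -> [k _ <-]; exists k => //; rewrite add0r.
Qed.

(** Each half-plane Re s > eps supplies its own coefficient. Two of them agree because both are the
    limit of the same means on the line Re s = 1, which eps <= 1/2 keeps inside. *)
Lemma ulim_dpoly_coef_all X F w : (forall eps, 0 < eps -> ulim_dpoly X eps F) ->
  exists a, (~ X w -> a = 0) /\
    forall sigma, 0 < sigma -> coefmean F sigma w @ \oo --> a.
Proof.
move=> hF; have h12 : (0 : R) < 2^-1 by rewrite invr_gt0.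
have [a [a0 ha]] := ulim_dpoly_coef w (hF _ h12).
exists a; split=> // sigma s0.
pose eps := Num.min (sigma / 2) 2^-1.
have eps0 : 0 < eps by rewrite lt_min; apply/andP; split; lra.
have e1 : eps <= sigma / 2 by rewrite ge_min lexx.
have e2 : eps <= 2^-1 by rewrite ge_min lexx orbT.
have [b [_ hb]] := ulim_dpoly_coef w (hF _ eps0).
have -> : a = b by apply: (cvgc_unique (ha 1 _) (hb 1 _)); lra.
by apply: hb; lra.
Qed.

Lemma generalized_integersP q lam : admissible q -> generalized_integers q lam ->
  [/\ lam 0%N = 1, forall j, 1 <= lam j &
      forall n c0 k, exists j, lam j = lam n ^+ c0 * k.+1%:R].
Proof.
move=> [_ _ q1 _] [laminc lamE].
have gen1 x : generators q x -> 1 <= x.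
  by move=> [[p pp <-]|[n _ <-]]; [rewrite ler1n prime_gt0|exact/ltW/q1].
have prod1 x : finite_products (generators q) x -> 1 <= x.
  move=> [s hs ->]; rewrite -[1]/(1 : R); elim: s hs => [|y s IH] hs.
    by rewrite big_nil.
  rewrite big_cons; apply: mulr_ege1; first by apply/gen1/hs; rewrite mem_head.
  by apply: IH => z zs; apply: hs; rewrite inE zs orbT.
have prodM x y : finite_products (generators q) x ->
    finite_products (generators q) y -> finite_products (generators q) (x * y).
  move=> [s hs ->] [s' hs' ->]; exists (s ++ s'); last by rewrite big_cat.
  by move=> z; rewrite mem_cat => /orP[/hs|/hs'].
have prodnat k : (0 < k)%N -> finite_products (generators q) k%:R.
  elim/ltn_ind: k => k IH k0; have [k1|k1] := leqP k 1.
    have -> : k = 1%N by apply/eqP; rewrite eqn_leq k1.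
    by exists [::] => //; rewrite big_nil.
  rewrite -(divnK (pdiv_dvd k)) natrM; apply: prodM.
    by apply: IH; rewrite ?divn_gt0 ?pdiv_gt0 ?pdiv_leq// ltn_Pdiv// prime_gt1// pdiv_prime.
  exists [:: (pdiv k)%:R]; last by rewrite big_seq1.
  move=> y; rewrite inE => /eqP ->; left; exists (pdiv k) => //.
  by rewrite /= pdiv_prime.
have lamP j : finite_products (generators q) (lam j) by rewrite -lamE; exists j.
have [j0 _ j0E] : range lam 1.
  by rewrite lamE; exists [::] => //; rewrite big_nil.
have lam1 j : 1 <= lam j by exact/prod1/lamP.
split=> [|//|n c0 k].
  apply/eqP; rewrite eq_le lam1 andbT -j0E laminc//.
suff [j _ <-] : range lam (lam n ^+ c0 * k.+1%:R) by exists j.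
rewrite lamE; apply: (prodM _ _ _ (prodnat _ _)) => //.
elim: c0 => [|c0 IH].
  by rewrite expr0; exists [::] => //; rewrite big_nil.
by rewrite exprS; exact: (prodM _ _ _ IH).
Qed.

End GordonHedenmalm.

(** * The matrix of the composition operator *)

Section CompositionMatrix.
Variable R : realType.
Implicit Types (z s a : R[i]) (x y sigma eps : R).
Implicit Types (psi : R[i] -> R[i]) (q lam : nat -> R) (b : nat -> nat -> R[i]).

Lemma coefmean_sum (F : nat -> R[i] -> R[i]) (c g : nat -> R[i]) sigma (w : R) N :
  (forall n, coefmean (F n) sigma w @ \oo --> g n) ->
  coefmean (fun s => \sum_(n < N) c n * F n s) sigma w @ \oo -->
    \sum_(n < N) c n * g n.
Proof.
move=> h; elim: N => [|N IH].
  under eq_fun do rewrite big_ord0; rewrite big_ord0.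
  rewrite (_ : coefmean _ _ _ = cst 0); first exact: cvg_cst.
  by rewrite /coefmean -(avg_cst R); congr (avg _); apply/funext => t; rewrite mul0r.
under eq_fun do rewrite big_ord_recr /=; rewrite big_ord_recr /=.
exact: (coefmean_cvgD IH (@coefmean_cvgZ _ (c N) _ _ _ _ (h N))).
Qed.

(** [b n j] is the mean coefficient of lam_n^(-psi) at ln lam_j. By linearity the sums over n in the
    second clause are the coefficients of a finite sum composed with psi, whose mean square is under
    control. *)
Lemma composition_matrix q lam psi : admissible q ->
  generalized_integers q lam -> G_ge1 psi -> exists b : nat -> nat -> R[i],
  (forall n s, halfplane 2^-1 s ->
    cvgn (series (fun j => normc (b n j * dexp (ln (lam j)) s))) /\
    series (fun j => b n j * dexp (ln (lam j)) s) @ \oo -->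
      dexp (ln (lam n)) (psi s)) /\
  (forall (a : nat -> R[i]) N J,
    \sum_(j < J) normc (\sum_(n < N) a n * b n j) ^+ 2 <=
    \sum_(n < N) normc (a n) ^+ 2).
Proof.
move=> hq hlam hpsi.
have [lam0 lam1 lamM] := generalized_integersP hq hlam.
have [c0 c01 [Repsi hF]] := G_ge1_exp hpsi.
pose l j := ln (lam j).
have lampos j : 0 < lam j by apply: lt_le_trans (lam1 j).
have linc : increasing_seq l.
  by move=> m n /=; rewrite /l ler_ln ?posrE// hlam.1.
have linj : injective l.
  by move=> m n e; apply/eqP; rewrite eqn_leq -!linc e lexx.
have l0 j : 0 <= l j by rewrite ln_ge0.
pose F n s := dexp (l n) (psi s).
have y0 n : 0 <= l n * c0%:R by rewrite mulr_ge0.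
have FU n eps : 0 < eps -> ulim_dpoly (shifted_logs (l n * c0%:R)) eps (F n).
  exact: hF.
have hb : forall p : nat * nat, exists a : R[i],
    (~ shifted_logs (l p.1 * c0%:R) (l p.2) -> a = 0) /\
    forall sigma, 0 < sigma -> coefmean (F p.1) sigma (l p.2) @ \oo --> a.
  by move=> p; apply: ulim_dpoly_coef_all; exact: FU.
have [b' b'P] := choice hb.
exists (fun n j => b' (n, j)); split=> [n|a N J].
  apply: (represents_of_coef linj (y0 n)).
  - move=> _ [k _ <-]; have [j jE] := lamM n c0 k; exists j => //.
    rewrite /l jE lnM ?posrE ?ltr0n ?exprn_gt0// lnXn// mulr_natr//.
  - exact: FU.
  - move=> s /Repsi h; rewrite normc_dexp expR_le1 oppr_le0.
    exact: mulr_ge0 (l0 n) h.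
  - by move=> j; exact: (b'P (n, j)).1.
  - by move=> sigma j; exact: (b'P (n, j)).2.
set B := \sum_(n < N) _; set S := \sum_(j < J) _.
pose G s := \sum_(n < N) a n * F n s.
(* For j < J the weight e^(-2 l_j sigma) in Bessel's sum is at least e^(-2 l_J sigma), which can be
   pulled out. *)
have key sigma : 0 < sigma -> S * expR (- (2 * (l J * sigma))) <= B.
  move=> s0.
  have hp t : halfplane 0 (sigma +i* t) by [].
  have mean0 y : 0 < y ->
      avg (fun t => dexp y (psi (sigma +i* t))) @ \oo --> (0 : R[i]).
    move=> ypos.
    have [c [cE hc]] : exists c, (~ shifted_logs (y * c0%:R) 0 -> c = 0) /\
        forall sigma, 0 < sigma ->
        coefmean (fun s => dexp y (psi s)) sigma 0 @ \oo --> c.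
      by apply: ulim_dpoly_coef_all => eps; apply: hF; exact: ltW.
    have -> : (fun t => dexp y (psi (sigma +i* t))) =
        fun t => dexp y (psi (sigma +i* t)) * dexp (- 0) (sigma +i* t).
      by apply/funext => t; rewrite oppr0 dexp0 mulr1.
    (* Every frequency is at least y c0, positive because [c0] is at least 1, so 0 is not among
       them. *)
    have {}cE : c = 0.
      apply: cE => -[k _ /eqP]; apply/negP; rewrite gt_eqF//.
      by rewrite ltr_wpDr ?mulr_gt0 ?ltr0n// ln_ge0// ler1n.
    by rewrite cE in hc; exact: hc.
  have hB eps : 0 < eps -> \forall n \near \oo,
      avg (fun t => normc (G (sigma +i* t)) ^+ 2) n <= B + eps.
    (* Since l 0 = ln 1 = 0, the normalised tail starting at 0 is the whole sum. *)
    move=> e0; have h := @avg_sqr_exp_sum_tail R (fun t => psi (sigma +i* t)) l a N 0 eps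
      (fun t => Repsi _ (hp t)) mean0 linc e0.
    apply: filterS h => n; congr (avg _ _ <= _); apply/funext => t.
    congr (normc _ ^+ 2); apply: eq_bigr => i _.
    by rewrite add0n /F {2}/l lam0 ln1 subr0.
  apply: le_trans (bessel_coef J linj _ hB); last first.
    by move=> j; apply: coefmean_sum => n; exact: (b'P (n, j)).2.
  rewrite mulr_suml; apply: ler_sum => j _; rewrite ler_wpM2l ?sqr_ge0//.
  rewrite ler_expR lerN2 ler_pM2l// ler_pM2r// linc ltnW//.
have S0 : 0 <= S by apply: sumr_ge0 => j _; exact: sqr_ge0.
apply/ler_addgt0Pr => e e0.
(* As e^(-t) >= 1 - t, [key] gives S - 2 l_J S sigma <= B, and this [sigma] makes the loss at most
   [e]; the added 1 keeps the denominator positive. *)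
pose sigma := e / (2 * l J * S + 1).
have D0 : 0 < 2 * l J * S + 1 by rewrite ltr_wpDl// !mulr_ge0.
have s0 : 0 < sigma by rewrite divr_gt0.
have := key _ s0; have := expR_ge1Dx (- (2 * (l J * sigma))).
move=> /(ler_wpM2l S0) h1 h2; have {h1} := le_trans h1 h2.
have : sigma * (2 * l J * S + 1) = e by rewrite divfK// gt_eqF.
move: s0 => /ltW; lra.
Qed.

Lemma series_combination lam psi b (a : nat -> R[i]) N :
  (forall n s, halfplane 2^-1 s ->
    cvgn (series (fun j => normc (b n j * dexp (ln (lam j)) s))) /\
    series (fun j => b n j * dexp (ln (lam j)) s) @ \oo -->
      dexp (ln (lam n)) (psi s)) ->
  forall s, halfplane 2^-1 s ->
    cvgn (series (fun j => normc ((\sum_(n < N) a n * b n j) * dexp (ln (lam j)) s))) /\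
    series (fun j => (\sum_(n < N) a n * b n j) * dexp (ln (lam j)) s) @ \oo -->
      \sum_(n < N) a n * dexp (ln (lam n)) (psi s).
Proof.
move=> h s hs; elim: N => [|N [IH1 IH2]].
  have E (f : nat -> R[i]) : (fun j => (\sum_(n < 0) a n * b n j) * f j) = fun=> 0.
    by apply/funext => j; rewrite big_ord0 mul0r.
  have E' (V : zmodType) : series (fun=> 0 : V) = cst 0.
    by apply/funext => n; rewrite /series /= big1.
  rewrite E big_ord0; split; last by rewrite E'; exact: cvg_cst.
  under eq_fun do rewrite big_ord0 mul0r normc0.
  by rewrite E'; exact: is_cvg_cst.
have [h1 h2] := h N s hs; split.
  have h1' := is_cvg_seriesD IH1 (@is_cvg_seriesZ _ _ (normc (a N)) h1).
  apply: series_le_cvg h1' => j.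
  - exact: normc_ge0.
  - by rewrite addr_ge0 ?normc_ge0// mulr_ge0 ?normc_ge0.
  - rewrite big_ord_recr /= mulrDl (le_trans (le_normcD _ _))// lerD2l.
    by rewrite -mulrA normcM.
rewrite big_ord_recr /=.
have -> : series (fun j => (\sum_(n < N.+1) a n * b n j) * dexp (ln (lam j)) s) =
  fun m => series (fun j => (\sum_(n < N) a n * b n j) * dexp (ln (lam j)) s) m +
    a N * series (fun j => b N j * dexp (ln (lam j)) s) m.
  apply/funext => m; rewrite /series /= mulr_sumr -big_split /=.
  by apply: eq_bigr => j _; rewrite big_ord_recr /= mulrDl -mulrA.
exact: (cvgD IH2 (cvgM (cvg_cst (a N)) h2)).
Qed.

End CompositionMatrix.

(** * The Hardy space and operators given by contractive matrices *)

Section HardySpaceTheory.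
Variable R : realType.
Implicit Types (f g : H2 R) (b : nat -> nat -> R[i]) (B e : R).

Lemma nondecreasing_series_sqr (u : nat -> R[i]) :
  nondecreasing_seq (series (fun n => normc (u n) ^+ 2)).
Proof.
apply/nondecreasing_seqP => n; rewrite /series /= big_nat_recr//= lerDl.
exact: sqr_ge0.
Qed.

Lemma H2_cvg f : cvgn (series (fun n => normc (f n) ^+ 2)).
Proof. by case: f => u /= /square_summableP. Qed.

Lemma H2norm_ge0 f : 0 <= H2norm f.
Proof. exact: sqrtr_ge0. Qed.

Lemma sqr_H2norm f :
  H2norm f ^+ 2 = limn (series (fun n => normc (f n) ^+ 2)).
Proof.
rewrite sqr_sqrtr//; apply: limr_ge; first exact: H2_cvg.
by apply: nearW => n; apply: sumr_ge0 => i _; exact: sqr_ge0.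
Qed.

Lemma sum_sqr_le_H2norm f J :
  \sum_(j < J) normc (f j) ^+ 2 <= H2norm f ^+ 2.
Proof.
rewrite sqr_H2norm -(big_mkord predT (fun j => normc (f j) ^+ 2)).
apply: nondecreasing_cvgn_le; first exact: nondecreasing_series_sqr.
exact: H2_cvg.
Qed.

Lemma normc_coef_le f j : normc (f j) <= H2norm f.
Proof.
rewrite -ler_sqr ?nnegrE ?normc_ge0 ?H2norm_ge0//.
apply: le_trans (sum_sqr_le_H2norm f j.+1); rewrite big_ord_recr /= lerDr.
by apply: sumr_ge0 => i _; exact: sqr_ge0.
Qed.

Lemma H2norm_le f B : 0 <= B ->
  (forall J, \sum_(j < J) normc (f j) ^+ 2 <= B ^+ 2) -> H2norm f <= B.
Proof.
move=> B0 h; rewrite -ler_sqr ?nnegrE ?H2norm_ge0// sqr_H2norm.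
apply: limr_le; first exact: H2_cvg.
by apply: nearW => J; rewrite /series /= big_mkord.
Qed.

Lemma square_summable_bounded (u : nat -> R[i]) B :
  (forall J, \sum_(j < J) normc (u j) ^+ 2 <= B) -> u \in @square_summable R.
Proof.
move=> h; apply/square_summableP; apply: nondecreasing_is_cvgn.
  exact: nondecreasing_series_sqr.
by exists B => _ [J _ <-]; rewrite /series /= big_mkord.
Qed.

Lemma eq_H2 f g : (forall j, f j = g j) -> f = g.
Proof.
case: f g => [u hu] [v hv] /= /funext uv; rewrite uv in hu *.
by congr MkH2; exact: bool_irrelevance.
Qed.

Lemma coefB f g j : (f - g : H2 R) j = f j - g j.
Proof. by []. Qed.
Fact truncation_subproof f N :
  (fun n => if (n < N)%N then f n else 0) \in @square_summable R.
Proof.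
apply: (@square_summable_bounded _ (H2norm f ^+ 2)) => J.
apply: le_trans (sum_sqr_le_H2norm f J); apply: ler_sum => j _.
by case: ifP => // _; rewrite normc0 expr0n /= sqr_ge0.
Qed.

Definition truncation f N : H2 R := MkH2 (truncation_subproof f N).

(** Writing the tail as a sequence with its first [m] entries set to 0 lets it serve as the [a] of
    the matrix inequality. *)
Lemma H2_tail f e : 0 < e -> exists N, forall m n, (N <= m)%N ->
  \sum_(i < n) normc (if (m <= i)%N then f i else 0) ^+ 2 <= e ^+ 2.
Proof.
move=> e0; have e2 : 0 < e ^+ 2 by rewrite exprn_gt0.
have /cvgrPdist_le/(_ _ e2)[N _ hN] := @H2_cvg f.
exists N => m n Nm; have {hN} := hN m Nm.
rewrite ler_norml -sqr_H2norm /series /= big_mkord => /andP[_ h].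
pose k := maxn m n.
apply: (@le_trans _ _ (\sum_(i < k) normc (if (m <= i)%N then f i else 0) ^+ 2)).
  rewrite /k [in leRHS](_ : maxn m n = n + (maxn m n - n))%N; last first.
    by rewrite subnKC// leq_maxr.
  rewrite big_split_ord /= lerDl; apply: sumr_ge0 => i _; exact: sqr_ge0.
apply: le_trans h; rewrite lerBrDr; apply: le_trans (sum_sqr_le_H2norm f k).
have -> : \sum_(i < m) normc (f i) ^+ 2 =
    \sum_(i < k) normc (if (i < m)%N then f i else 0) ^+ 2.
  rewrite (big_ord_widen k (fun i => normc (f i) ^+ 2)) ?leq_maxl// big_mkcond.
  by apply: eq_bigr => i _; case: ifP => //; rewrite normc0 expr0n.
rewrite -big_split /=; apply: ler_sum => i _.
by case: ltnP => _; rewrite normc0 expr0n /= ?addr0 ?add0r.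
Qed.

Lemma truncation_dist f e : 0 < e ->
  exists N, forall m, (N <= m)%N -> H2norm (f - truncation f m) <= e.
Proof.
move=> e0; have [N hN] := H2_tail f e0; exists N => m Nm.
apply: H2norm_le => [|J]; first exact: ltW.
apply: le_trans (hN m J Nm); apply: ler_sum => j _.
by rewrite coefB /=; case: ltnP; rewrite ?subrr ?subr0.
Qed.

(** One summand of the hypothesis bounds a -> sum_n a_n b_nj in the l^2 norm, so these sums are
    Cauchy in N. For fixed J the inequality passes to the limit in N, which yields both square
    summability of the image and contractivity. *)
Lemma matrix_operator b :
  (forall (a : nat -> R[i]) N J,
    \sum_(j < J) normc (\sum_(n < N) a n * b n j) ^+ 2 <=
    \sum_(n < N) normc (a n) ^+ 2) ->
  exists T : {linear H2 R -> H2 R},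
    (forall f j, (fun N => \sum_(n < N) f n * b n j) @ \oo --> T f j) /\
    forall f, H2norm (T f) <= H2norm f.
Proof.
move=> hb.
have coef_le (a : nat -> R[i]) N j : normc (\sum_(n < N) a n * b n j) ^+ 2 <=
    \sum_(n < N) normc (a n) ^+ 2.
  apply: le_trans (hb a N j.+1); rewrite big_ord_recr /= lerDr.
  by apply: sumr_ge0 => i _; exact: sqr_ge0.
have hlim (p : H2 R * nat) : exists z : R[i],
    (fun N => \sum_(n < N) p.1 n * b n p.2) @ \oo --> z.
  case: p => f j /=; apply: cvgc_cauchy => e e0.
  have [N hN] := H2_tail f e0; exists N.
  have key m n : (N <= m)%N -> (m <= n)%N ->
      normc (\sum_(i < n) f i * b i j - \sum_(i < m) f i * b i j) <= e.
    move=> Nm mn; rewrite -ler_sqr ?nnegrE ?normc_ge0 ?(ltW e0)//.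
    apply: le_trans (hN m n Nm).
    apply: le_trans (coef_le (fun i => if (m <= i)%N then f i else 0) n j).
    rewrite (big_ord_widen n (fun i => f i * b i j) mn).
    rewrite [X in _ - X]big_mkcond -sumrB le_eqVlt; apply/orP; left; apply/eqP.
    congr (normc _ ^+ 2); apply: eq_bigr => i _.
    by case: ltnP; rewrite ?subrr ?mul0r ?subr0.
  move=> m n hm hn; have [mn|/ltnW nm] := leqP m n; last exact: key.
  by rewrite normcBC; exact: key.
have [Tc TcP] := choice hlim.
have Tbound f J : \sum_(j < J) normc (Tc (f, nat_of_ord j)) ^+ 2 <= H2norm f ^+ 2.
  have hc : (fun N => \sum_(j < J) normc (\sum_(n < N) f n * b n j) ^+ 2) @ \oo -->
      \sum_(j < J) normc (Tc (f, nat_of_ord j)) ^+ 2.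
    apply: cvg_big => [|j _]; first exact: add_continuous.
    have h := cvgc_normc (TcP (f, nat_of_ord j)).
    exact: (cvgM h h).
  rewrite -(cvg_lim _ hc)//; apply: limr_le; first by apply/cvg_ex; eexists; exact: hc.
  apply: nearW => N; exact: le_trans (hb _ _ _) (sum_sqr_le_H2norm f N).
pose T := fun f : H2 R =>
  MkH2 (@square_summable_bounded (fun j => Tc (f, j)) _ (Tbound f)).
have Tlin : linear T.
  move=> k f g; apply: eq_H2 => j.
  apply: (cvgc_unique (TcP (k *: f + g, j))).
  have -> : (fun N => \sum_(n < N) (k *: f + g : H2 R) n * b n j) =
     fun N => k * \sum_(n < N) f n * b n j + \sum_(n < N) g n * b n j.
    apply/funext => N; rewrite mulr_sumr -big_split /=; apply: eq_bigr => n _.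
    by transitivity ((k * f n + g n) * b n j) => //; rewrite mulrDl mulrA.
  exact: (cvgD (cvgM (cvg_cst k) (TcP (f, j))) (TcP (g, j))).
pose L := GRing.isLinear.Build R[i] (H2 R) (H2 R) *:%R T Tlin.
pose T' : {linear H2 R -> H2 R} := HB.pack T L.
exists T'; split=> [f j|f]; first exact: (TcP (f, j)).
by apply: H2norm_le => [|J]; [exact: H2norm_ge0|exact: Tbound].
Qed.

Lemma sum_sqr_delta0_le1 J :
  \sum_(j < J) normc ((j == 0 :> nat)%:R : R[i]) ^+ 2 <= 1.
Proof.
have E n : normc ((n == 0 :> nat)%:R : R[i]) ^+ 2 = (n == 0)%:R.
  by case: eqP => _; rewrite ?normc1 ?normc0 ?expr1n ?expr0n.
under eq_bigr do rewrite E.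
by case: J => [|J]; rewrite ?big_ord0// big_ord_recl big1 ?addr0.
Qed.

(** The constant function 1, because lam 0 = 1. *)
Definition delta0 : H2 R := MkH2
  (@square_summable_bounded (fun j => (j == 0 :> nat)%:R) _ sum_sqr_delta0_le1).

Lemma H2norm_delta0_le1 : H2norm delta0 <= 1.
Proof. by apply: H2norm_le => // J; rewrite expr1n; exact: sum_sqr_delta0_le1. Qed.

End HardySpaceTheory.

(** * Existence, uniqueness and norm of the composition operator *)

Theorem theorem1p1 (R : realType) (q lam : nat -> R)
    (hq : admissible q) (hlam : generalized_integers q lam)
    (psi : R[i] -> R[i]) (hpsi : G_ge1 psi) :
  (exists C_psi : {linear H2 R -> H2 R}, composition_operator lam psi C_psi) /\
  (forall C_psi : {linear H2 R -> H2 R}, composition_operator lam psi C_psi ->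
     operator_norm C_psi = 1).
Proof.
have [lam0 lam1 _] := generalized_integersP hq hlam.
have [b [brep bcontr]] := composition_matrix hq hlam hpsi.
have [T [Tcoef Tcontr]] := matrix_operator bcontr.
have linc : increasing_seq (fun j => ln (lam j)).
  by move=> m n /=; rewrite ler_ln ?posrE ?(lt_le_trans ltr01)// hlam.1.
have finite_coef (f : H2 R) N j : (forall n, (N <= n)%N -> f n = 0) ->
    T f j = \sum_(n < N) f n * b n j.
  move=> fN; apply: (cvgc_unique (Tcoef f j)); apply/cvgcP => e e0.
  exists N => // m /= Nm; rewrite (big_ord_widen m (fun n => f n * b n j) Nm).
  rewrite big_mkcond -sumrB big1 ?normc0 ?ltW// => i _.
  by case: ltnP => [|/fN ->]; rewrite ?subrr// mul0r subr0.
split.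
  exists T; split; first by exists 1 => f; rewrite mul1r.
  move=> f N fN s hs; have := series_combination f N brep hs.
  rewrite /gds_term; have -> : (fun j => (\sum_(n < N) f n * b n j) * dexp (ln (lam j)) s) =
    (fun j => T f j * powN (lam j) s).
    by apply/funext => j; rewrite (finite_coef f N).
  by under eq_fun do rewrite -(finite_coef f N _ fN).
move=> C [[M hM] hC].
have uniq_coef (g h : nat -> R[i]) (F : R[i] -> R[i]) :
    (forall s, halfplane 2^-1 s ->
      cvgn (series (fun j => normc (g j * dexp (ln (lam j)) s))) /\
      series (fun j => g j * dexp (ln (lam j)) s) @ \oo --> F s) ->
    (forall s, halfplane 2^-1 s ->
      cvgn (series (fun j => normc (h j * dexp (ln (lam j)) s))) /\
      series (fun j => h j * dexp (ln (lam j)) s) @ \oo --> F s) ->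
    forall j, g j = h j.
  move=> hg hh j; apply/eqP; rewrite -subr_eq0; apply/eqP; move: j.
  apply: (dirichlet_coef_eq0 linc) => s hs.
  have [g1 g2] := hg s hs; have [h1 h2] := hh s hs; split.
    apply: series_le_cvg (is_cvg_seriesD g1 h1) => j.
    - exact: normc_ge0.
    - by rewrite addr_ge0 ?normc_ge0.
    - by rewrite mulrBl (le_trans (le_normcD _ _))// normcN.
  rewrite -(subrr (F s)).
  have -> : series (fun j => (g j - h j) * dexp (ln (lam j)) s) =
    fun m => series (fun j => g j * dexp (ln (lam j)) s) m -
             series (fun j => h j * dexp (ln (lam j)) s) m.
    apply/funext => m; rewrite /series /= -sumrB.
    by apply: eq_bigr => j _; rewrite mulrBl.
  exact: (cvgB g2 h2).
(* The definition prescribes [C] on finite sums only. There uniqueness of coefficients gives the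
   matrix, and boundedness carries this from truncations to [f]; [M] is replaced by |M| + 1 to have
   a positive divisor. *)
have CT f j : C f j = T f j.
  apply: cvgc_unique (Tcoef f j); apply/cvgcP => e e0.
  have hM0 : 0 < `|M| + 1 by rewrite ltr_wpDl.
  have [N hN] := truncation_dist f (divr_gt0 e0 hM0).
  exists N => // m /= Nm.
  have tz n : (m <= n)%N -> truncation f m n = 0.
    by move=> mn /=; rewrite ltnNge mn.
  have -> : \sum_(n < m) f n * b n j = C (truncation f m) j.
    have -> : \sum_(n < m) f n * b n j = \sum_(n < m) truncation f m n * b n j.
      by apply: eq_bigr => i _ /=; rewrite ltn_ord.
    move: j; apply: uniq_coef; first exact: series_combination brep.
    exact: hC tz.
  rewrite -coefB -linearB; apply: le_trans (normc_coef_le _ _) _.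
  apply: le_trans (hM _) _.
  apply: (@le_trans _ _ ((`|M| + 1) * (e / (`|M| + 1)))).
    apply: (@le_trans _ _ ((`|M| + 1) * H2norm (f - truncation f m))).
      by rewrite ler_wpM2r ?H2norm_ge0//; have := ler_norm M; lra.
    by rewrite ler_wpM2l ?hN// ltW.
  by rewrite mulrC divfK// gt_eqF.
have Ccontr f : H2norm (C f) <= H2norm f.
  by have -> : C f = T f by apply: eq_H2 => j; exact: CT.
have C1 : 1 <= H2norm (C (delta0 R)).
  suff E : C (delta0 R) 0%N = 1.
    by apply: le_trans (normc_coef_le _ 0%N); rewrite E normc1.
  have dz n : (1 <= n)%N -> delta0 R n = 0 by case: n.
  have dE (s : R[i]) : \sum_(n < 1) gds_term lam (delta0 R) (psi s) n = 1.
    by rewrite big_ord1 /gds_term /= mul1r lam0 /powN ln1 mul0r oppr0 cexp0.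
  (* Both series represent the constant function 1, since lam_0^(-psi) = 1. *)
  suff -> : C (delta0 R) 0%N = delta0 R 0%N by [].
  move: 0%N; apply: (uniq_coef _ _ (fun=> 1)) => s hs.
    by have := hC _ _ dz s hs; rewrite dE.
  have dE' j : delta0 R j * dexp (ln (lam j)) s = (j == 0%N)%:R.
    by case: j => [|j]; rewrite ?mul0r// lam0 ln1 dexp0 mulr1.
  split.
    under eq_fun do rewrite dE'.
    apply/cvg_ex; exists 1; apply: cvg_near_cst; exists 1%N => // -[//|m] _.
    rewrite /series /= big_mkord big_ord_recl big1 ?addr0 ?normc1// => i _.
    by rewrite normc0.
  under eq_fun do rewrite dE'.
  apply: cvg_near_cst; exists 1%N => // -[//|m] _.
  by rewrite /series /= big_mkord big_ord_recl big1 ?addr0.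
apply/eqP; rewrite eq_le /operator_norm; apply/andP; split.
  apply: ge_sup; first by exists (H2norm (C (delta0 R))), (delta0 R) => //; exact: H2norm_delta0_le1.
  by move=> _ [f /= f1 <-]; exact: le_trans (Ccontr f) f1.
apply: le_trans C1 _; apply: ub_le_sup; last by exists (delta0 R) => //; exact: H2norm_delta0_le1.
by exists 1 => _ [f /= f1 <-]; exact: le_trans (Ccontr f) f1.
Qed.
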